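(* Let $f:\mathbb{R}^n\to\mathbb{R}^n$ be a Lipschitz mapping such that $\partial f(x)$ has maximal rank for every $x\in\mathbb{R}^n$. Suppose that there exists a sequence $(D_k)$ of compact discs of $\mathbb{C}$ (with nonempty interior), centered at points $t_k$ of the real axis, such that $\lim_{k\to\infty}t_k=0$ and $$\operatorname{Spec}(\partial f(x))\cap\Big(\bigcup_{k=1}^\infty D_k\Big)=\emptyset\quad\text{for all }x\in\mathbb{R}^n.$$ Then $f$ is injective.
   Context: For a Lipschitz mapping $f:\mathbb{R}^n\to\mathbb{R}^n$, the Clarke generalized differential $\partial f(x)$ is the convex hull of all limits $\lim_i df(x_i)$ with $x_i\to x$ and $f$ differentiable at each $x_i$, where $df(x_i)$ is identified with the Jacobian matrix. $\partial f(x)$ has maximal rank if every matrix in $\partial f(x)$ is invertible. $\operatorname{Spec}(\partial f(x))$ denotes the set of all complex eigenvalues of all matrices $A\in\partial f(x)$. *)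

(* Defs.v *)
From HB Require Import structures.
From mathcomp Require Import all_boot all_order all_algebra.
From mathcomp Require Import all_classical all_reals all_analysis.
From mathcomp Require Import complex.

Set Implicit Arguments.
Unset Strict Implicit.
Unset Printing Implicit Defensive.

Import Order.TTheory GRing.Theory Num.Theory.
Import numFieldNormedType.Exports.

Local Open Scope classical_set_scope.
Local Open Scope ring_scope.
Local Open Scope complex_scope.

(* Points of R^n are row vectors. Matrices therefore act on the right: the
   differential of f at p is v |-> v *m 'J f p, so that 'J f p is the transpose
   of the usual Jacobian matrix, and [eigenvalue] in mathcomp likewise refers to
   v *m A = a *: v. *)
Definition limiting_jacobians (R : realType) (n : nat)
    (f : 'rV[R]_n -> 'rV[R]_n) (x : 'rV[R]_n) : set 'M[R]_n :=
  [set A | exists u : nat -> 'rV[R]_n,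
     [/\ u @ \oo --> x,
         forall i, differentiable f (u i) &
         (fun i => 'J f (u i)) @ \oo --> A]].

Definition convex_hull (R : numDomainType) (M : lmodType R) (S : set M)
    : set M :=
  smallest (@convex_set R M) S.

Definition clarke_differential (R : realType) (n : nat)
    (f : 'rV[R]_n -> 'rV[R]_n) (x : 'rV[R]_n) : set 'M[R]_n :=
  convex_hull (limiting_jacobians f x).

Definition maximal_rank (R : realType) (n : nat) (S : set 'M[R]_n) : Prop :=
  forall A, S A -> A \in unitmx.

Definition Spec (R : realType) (n : nat) (S : set 'M[R]_n) : set R[i] :=
  [set z | exists2 A, S A & eigenvalue (map_mx (real_complex R) A) z].

(* The order on R[i] only relates numbers with equal imaginary parts; here both
   sides of <= are real. *)
Definition closed_disc (R : realType) (c : R[i]) (r : R) : set R[i] :=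
  [set z | `|z - c| <= r%:C].

(* Main.v *)
(** Every shift [f_k x = f x - t_k x] is injective, and injectivity passes to
    the limit: if [f a = f b] with [a <> b], solving [f_k a_k = f a] near [a]
    and [f_k b_k = f b] near [b] gives two distinct points with the same
    image.

    Avoiding the discs makes [|det (A - t_k)|], a product of distances from
    [t_k] to eigenvalues, uniformly positive, hence [A - t_k] uniformly
    invertible over all generalized Jacobians. For a fixed vector [v], the
    vectors [v (A - t_k)], with [A] in the compact convex set of generalized
    Jacobians at a point, then lie in a half-space away from [0], and a mean
    value inequality for Lipschitz maps (from Rademacher's theorem and Fubini)
    shows that [f_k] is locally expansive, with one constant for the whole
    space, and that [|y - f_k x|^2] has no local minimum in [x] except at
    solutions, which gives local surjectivity. If [f_k a = f_k b], the loop
    [f_k [a, b]] is contracted to a point along straight lines; the uniform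
    constant allows the contraction to be lifted on a fine grid, so that
    [a = b]. *)

Require Import Defs.
From HB Require Import structures.
From mathcomp Require Import all_boot all_order all_algebra.
From mathcomp Require Import perm.
From mathcomp Require Import all_classical all_reals all_analysis.
From mathcomp Require Import measurable_realfun.
From mathcomp Require Import complex ring lra zify.

Set Implicit Arguments.
Unset Strict Implicit.
Unset Printing Implicit Defensive.

Import Order.TTheory GRing.Theory Num.Theory.
Import numFieldNormedType.Exports.

Local Open Scope classical_set_scope.
Local Open Scope ring_scope.

(** * Lipschitz functions of one variable *)

(** The shifts are forced by the lack of a global bound for [f] itself: maximal rank bounds the
    inverses of generalized Jacobians only through compactness, with a constant that varies with the
    point, and a local homeomorphism need not be injective. A disc of radius [r] around [t_k] gives
    [|det (A - t_k)| >= r^n] at every point at once, and since [|A| <= K] the adjugate formula turns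
    this into one coercivity constant.

    Generalized Jacobians see [f] only at its points of differentiability, whereas a mean value
    inequality runs along a segment that may avoid all of them. Fubini replaces the segment by a
    parallel one, arbitrarily near, almost all of whose points are good.

    Coercivity is used for [A - t_k] and for its transpose: separating the vectors [v (A - t_k)]
    from [0] gives expansivity, and separating the vectors [w (A - t_k)^T] gives a direction in
    which [f_k] advances along [w]. *)

Lemma lipschitz_bound_continuous (R : realFieldType) (V W : normedModType R) (f : V -> W)
    (K : R) :
  (forall x y, `|f x - f y| <= K * `|x - y|) -> continuous f.
Proof.
move=> fK x; apply/cvgrPdist_le => e e0; near=> y.
apply: le_trans (fK _ _) _.
apply: (@le_trans _ _ ((`|K| + 1) * `|x - y|)).
  by apply: ler_wpM2r => //; rewrite (le_trans (ler_norm _))// lerDl.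
rewrite mulrC -ler_pdivlMr ?ltr_wpDl//.
by near: y; apply: cvgr_dist_le => //; rewrite divr_gt0// ltr_wpDl.
Unshelve. all: by end_near. Qed.

Section lipschitz_line.
Context {R : realType}.
Local Notation mu := (@lebesgue_measure R).

Lemma lebesgue_null_cover (A : set R) (e : R) : mu A = 0%E -> 0 < e ->
  exists C : nat -> R * R, [/\ forall i, (C i).1 <= (C i).2,
    A `<=` \bigcup_i `](C i).1, (C i).2]%classic &
    (\sum_(0 <= i <oo) ((C i).2 - (C i).1)%:E <= e%:E)%E].
Proof.
move=> A0 e0.
have A0' : mu_ext (wlength (idfun : R -> R)) A = 0%E := A0.
have /(lb_ereal_inf_adherent e0) : mu_ext (wlength (idfun : R -> R)) A \is a fin_num.
  by rewrite A0'.
rewrite -/(mu_ext _ _) A0' add0e => -[_ [C [mC AC] <-] Clt].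
have /choice[D DP] : forall i, exists p : R * R, p.1 <= p.2 /\ C i = `]p.1, p.2]%classic.
  move=> i; have [[a b] _ <-] := mC i => /=.
  have [ab|ba] := leP a b; first by exists (a, b).
  (* Endpoints in the wrong order describe the empty interval, and so does []a, a]]. *)
  exists (a, a); split => //=.
  by rewrite !set_itv_ge// bnd_simp -leNgt// ltW.
exists D; split => [i||]; first by case: (DP i).
  by move=> x /AC[i _]; rewrite (DP i).2 => ?; exists i.
apply: le_trans (ltW Clt); apply: lee_nneseries => [i _ _|i _].
  by rewrite lee_fin subr_ge0; case: (DP i).
by rewrite (DP i).2 wlength_itv_bnd//; case: (DP i).
Qed.

Lemma stieltjes_null_cover (F : cumulative R R) (A : set R) :
  (forall e : R, 0 < e -> exists C : nat -> R * R,
    [/\ forall i, (C i).1 <= (C i).2,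
    A `<=` \bigcup_i `](C i).1, (C i).2]%classic &
    (\sum_(0 <= i <oo) (F (C i).2 - F (C i).1)%:E <= e%:E)%E]) ->
  lebesgue_stieltjes_measure F A = 0%E.
Proof.
move=> cover; apply/eqP; rewrite eq_le measure_ge0 andbT.
apply/lee_addgt0Pr => e e0; rewrite add0e.
have [C [C12 AC Ce]] := cover _ e0.
apply: (@le_trans _ _ (\sum_(0 <= k <oo) wlength F `](C k).1, (C k).2]%classic)%E).
  apply: ereal_inf_lbound; exists (fun i => `](C i).1, (C i).2]%classic) => //.
  by split => // i; exact: is_ocitv.
apply: le_trans Ce; apply: lee_nneseries => [i _ _|i _]; first exact: wlength_ge0.
by rewrite wlength_itv_bnd.
Qed.

Lemma lebesgue_stieltjes_null (F : cumulative R R) (K : R) (A : set R) :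
  (forall x y, x <= y -> F y - F x <= K * (y - x)) ->
  mu A = 0%E -> lebesgue_stieltjes_measure F A = 0%E.
Proof.
move=> FK A0; apply: stieltjes_null_cover => e e0.
have K0 : 0 <= K.
  have := FK 0 1 ler01; rewrite subr0 mulr1; apply: le_trans.
  by rewrite subr_ge0; apply: (cumulative_is_nondecreasing F).
have K1 : 0 < K + 1 by lra.
have eK : 0 < e / (K + 1) by rewrite divr_gt0.
have [C [C12 AC Ce]] := lebesgue_null_cover A0 eK.
exists C; split => //.
apply: (@le_trans _ _ (\sum_(0 <= k <oo) ((K + 1)%:E * ((C k).2 - (C k).1)%:E))%E).
  apply: lee_nneseries => [i _ _|i _].
    by rewrite lee_fin subr_ge0; apply: (cumulative_is_nondecreasing F).
  rewrite -EFinM lee_fin.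
  by apply: le_trans (FK _ _ (C12 i)) _; apply: ler_wpM2r; rewrite ?subr_ge0//; lra.
rewrite nneseriesZl; last by move=> i _; rewrite lee_fin subr_ge0.
apply: (@le_trans _ _ ((K+1)%:E * (e / (K + 1))%:E)%E).
  by apply: lee_wpmul2l => //; rewrite lee_fin ltW.
by rewrite -EFinM lee_fin mulrC mulfVK// gt_eqF.
Qed.

Lemma lebesgue_null_shift (b : R) (A : set R) :
  mu A = 0%E -> mu ((fun x => x + b) @^-1` A) = 0%E.
Proof.
move=> A0; apply: (@stieltjes_null_cover idfun) => e e0.
have [C [C12 AC Ce]] := lebesgue_null_cover A0 e0.
exists (fun i => ((C i).1 - b, (C i).2 - b)) => /=; split => //=.
- by move=> i; rewrite lerD2r.
- move=> x /AC[i _] /=; rewrite in_itv/= => xC; exists i => //=.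
  by rewrite in_itv/= ltrBlDr lerBrDr.
apply: le_trans Ce; apply: lee_nneseries => [i _ _|i _].
  by rewrite lee_fin subr_ge0 lerD2r.
by rewrite lee_fin opprB addrA subrK.
Qed.

(** Adding [K * x] makes [phi] nondecreasing, so that it defines a Stieltjes measure, absolutely
    continuous because [phi] is Lipschitz. Its Radon-Nikodym density is [g], and Lebesgue
    differentiation recovers the derivative from [g] almost everywhere. *)
Lemma lipschitz_primitive (phi : R -> R) (K a b : R) : a < b ->
  (forall x y, `|phi x - phi y| <= K * `|x - y|) ->
  exists g : R -> R, [/\ forall x, 0 <= g x,
    mu.-integrable setT (EFin \o g),
    forall x, a <= x <= b -> ((phi x + K * x) - (phi a + K * a))%:E = (\int[mu]_(t in `]a, x]) (g t)%:E)%E &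
    {ae mu, forall x, a < x < b -> is_derive x 1 phi (g x - K)}].
Proof.
move=> ab lipphi.
pose psi x := phi x + K * x.
have K0 : 0 <= K by have := le_trans (normr_ge0 _) (lipphi 1 0); rewrite subr0 normr1 mulr1.
have psi_nd : nondecreasing psi.
  move=> x y xy; rewrite /psi -subr_ge0.
  have := lipphi y x; rewrite ler_norml (ger0_norm (x := y - x)) ?subr_ge0//.
  by move=> /andP[]; nra.
have psi_c : continuous psi.
  move=> x; apply: continuousD; last by apply: continuousM => //; exact: cst_continuous.
  exact: (lipschitz_bound_continuous lipphi).
have psi_lip x y : x <= y -> psi y - psi x <= (K + K) * (y - x).
  move=> xy; rewrite /psi.
  have := lipphi y x; rewrite ler_norml (ger0_norm (x := y - x)) ?subr_ge0//.
  by move=> /andP[]; nra.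
pose m := isCumulative.Build R _ R psi psi_nd (right_continuousW psi_c).
pose F : cumulative R R := HB.pack psi m.
pose I : set (measurableTypeR R) := `]a, b]%classic.
have mI : measurable I by exact: measurable_itv.
have nuE x y : x <= y -> lebesgue_stieltjes_measure F `]x, y]%classic = (psi y - psi x)%:E.
  move=> xy.
  rewrite -[LHS]/(measure_extension (wlength F) _) /measure_extension measurable_mu_extE; last exact: is_ocitv.
  exact: wlength_itv_bnd.
have nuI : (lebesgue_stieltjes_measure F I < +oo)%E by rewrite nuE ?ltry// ltW.
(* Restricting to []a, b]] makes the measure finite, as Radon-Nikodym requires. *)
pose nu := mfrestr mI nuI.
have numu : nu `<< mu.
  move=> N N0 A mA AN; rewrite /nu /mfrestr /mrestr.
  apply: (@lebesgue_stieltjes_null F (K + K)) => //; apply: N0; first exact: measurableI.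
  by move=> x [/AN].
have [h [h0 hfin hint hE]] := radon_nikodym_sigma_finite numu.
pose g := fine \o h.
have gE : EFin \o g = h by apply/funext => x; rewrite /g /= fineK.
have intE x : a <= x <= b ->
    (psi x - psi a)%:E = (\int[mu]_(t in `]a, x]) (g t)%:E)%E.
  move=> /andP[ax xb].
  under eq_integral do rewrite -[(g _)%:E]/((EFin \o g) _) gE.
  rewrite -hE/= /mfrestr /mrestr ?setIidl ?nuE//.
  by apply: subset_itvl; rewrite bnd_simp.
exists g; split => //.
- by move=> x; rewrite fine_ge0.
- by rewrite gE.
have gi A : measurable A -> mu.-integrable A (EFin \o g).
  by move=> mA; apply: (@integrableS _ _ _ _ setT); rewrite ?gE.
have gloc : locally_integrable [set: R] g.
  by apply: open_integrable_locally; [exact: openT|rewrite gE].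
have := @FTC1 R g (BRight a) (fun y => gi _ (measurable_itv _)) gloc.
apply: filterS; first exact: (ae_filter_ringOfSetsType mu).
move=> x /= dF /andP[ax xb].
have [] := dF; first by rewrite lte_fin.
set G := (fun _ => _) => dG gx.
have phiE : \forall y \near x, (G y + (phi a + K * a)) - K * y = phi y.
  have : \forall y \near x, a <= y <= b.
    near=> y; apply/andP; split; near: y; [exact: lt_le_nbhsr | exact: lt_le_nbhsl].
  apply: filterS => y ayb; rewrite /G /Rintegral.
  by rewrite -intE//= /psi; ring.
have dG' : is_derive x 1 G (g x).
  by split; [exact: dG|rewrite -derive1E].
apply: (near_eq_is_derive phiE).
have := is_deriveB (is_deriveD dG' (is_derive_cst (phi a + K * a) x 1)) (is_deriveZ K (is_derive_id x 1)).
by rewrite addr0 [K *: 1]mulr1.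
Unshelve. all: by end_near. Qed.

Lemma lipschitz_ae_derivable (phi : R -> R) (K : R) :
  (forall x y, `|phi x - phi y| <= K * `|x - y|) ->
  mu.-negligible [set x | ~ derivable phi x 1].
Proof.
move=> lipphi.
pose B k := [set x : R | ~ (- k.+1%:R < x < k.+1%:R -> derivable phi x 1)].
have : mu.-negligible (\bigcup_k B k).
  apply: negligible_bigcup => k.
  have kk : (- k.+1%:R : R) < k.+1%:R by rewrite -subr_gt0 opprK addr_gt0.
  have [g [_ _ _]] := lipschitz_primitive kk lipphi.
  by apply: negligibleS => x /= nd; apply: contra_not nd => h /h[].
apply: negligibleS => x /= nd; exists (Num.bound x) => //= dx; apply: nd; apply: dx.
rewrite -ltr_norml; apply: lt_trans (_ : (Num.bound x)%:R < _); last by rewrite ltr_nat.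
exact: unstable.ltr_norm_bound.
Qed.

Lemma lipschitz_increment_ge (phi : R -> R) (K a b c : R) (N : set R) : a <= b ->
  (forall x y, `|phi x - phi y| <= K * `|x - y|) -> mu.-negligible N ->
  (forall t d, a < t < b -> ~ N t -> is_derive t 1 phi d -> c <= d) ->
  c * (b - a) <= phi b - phi a.
Proof.
rewrite le_eqVlt => /predU1P[-> _ _ _|ab lipphi N0 cd]; first by rewrite !subrr mulr0.
(* The Lipschitz constant is enlarged by [|c|] so that [c + K'] is nonnegative and the comparison
   takes place between integrals of nonnegative functions. *)
have lipphi' x y : `|phi x - phi y| <= (K + `|c|) * `|x - y|.
  by apply: le_trans (lipphi _ _) _; apply: ler_wpM2r => //; rewrite lerDl.
have [g [g0 gint gE dg]] := lipschitz_primitive ab lipphi'.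
have K0 : 0 <= K by have := le_trans (normr_ge0 _) (lipphi 1 0); rewrite subr0 normr1 mulr1.
set K' := K + `|c| in lipphi' gE dg.
have cK : 0 <= c + K' by rewrite /K'; have := ler_norm (- c); rewrite normrN; lra.
suff : (((c + K') * (b - a))%:E <= ((phi b + K' * b) - (phi a + K' * a))%:E)%E.
  by rewrite lee_fin; lra.
rewrite gE; last by rewrite lexx ltW.
have -> : ((c + K') * (b - a))%:E = (\int[mu]_(t in `]a, b]) (c + K')%:E)%E.
  rewrite integral_cst//= lebesgue_measure_itv/= lte_fin ab -EFinB -EFinM//.
apply: ae_ge0_le_integral => //.
- by move=> x _; rewrite lee_fin.
- by case/integrableP : gint => mg _; exact: (measurable_funTS mg).
(* The integral runs over []a, b]], but derivatives are known only inside []a, b[]. *)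
have Nb : mu.-negligible [set b] by apply/negligibleP; [exact: measurable_set1|exact: lebesgue_measure_set1].
apply: negligibleS (negligibleU (negligibleU N0 Nb) dg) => x /=.
apply: contra_notP => /not_orP[/not_orP[Nx xb]] /contrapT dgx.
rewrite in_itv/= => /andP[ax xlb]; rewrite lee_fin -lerBrDr.
have axb : a < x < b by rewrite ax lt_neqAle xlb andbT; apply/eqP.
exact: cd axb Nx (dgx axb).
Qed.

Lemma lebesgue_measure_ball_diff (A : set R) (x y r q : R) : measurable A ->
  0 <= r -> 0 <= q -> ball y q `<=` ball x r -> A `<=` ball x r `\` ball y q ->
  (mu A <= (r *+ 2 - q *+ 2)%:E)%E.
Proof.
move=> mA r0 q0 yx AB.
pose B : set (measurableTypeR R) := ball x r.
pose C : set (measurableTypeR R) := ball y q.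
have mB : measurable B := measurable_ball x r.
have mC : measurable C := measurable_ball y q.
have muB : mu B = (r *+ 2)%:E := lebesgue_measure_ball x r0.
have muC : mu C = (q *+ 2)%:E := lebesgue_measure_ball y q0.
have Boo : (mu B < +oo)%E by rewrite muB ltry.
apply: (@le_trans _ _ (mu (B `\` C))).
  exact: (le_measure mu (mem_set mA) (mem_set (measurableD mB mC)) AB).
have BC : B `&` C = C := setIidr yx.
have -> : mu (B `\` C) = (mu B - mu C)%E by rewrite -[in RHS]BC; exact: measureD.
by rewrite muB muC -EFinB.
Qed.

(** At a density point, [A] cannot miss the ball of radius [e * |s|] around [x + s]: inside the ball
    of radius [2 * |s|] around [x], this hole has the fixed proportion [e / 2]. *)
Lemma density_point_near (A : set R) : measurable A ->
  mu.-negligible [set x | A x /\ ~ forall e, 0 < e ->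
    exists2 d, 0 < d & forall s, `|s| < d -> exists2 s', `|s' - s| <= e * `|s| & A (x + s')].
Proof.
move=> mA; apply: negligibleS (lebesgue_density mA) => x /= [Ax nx].
apply: contra_not nx => /= dens e e0.
wlog e1 : e e0 / e < 1.
  move=> H; have := H (Num.min e (1/2)); rewrite lt_min gt_min e0 => -[||d d0 dP].
  - by lra.
  - by apply/orP; right; lra.
  exists d => // s /dP[s' s's As']; exists s' => //; apply: le_trans s's _.
  by apply: ler_wpM2r => //; rewrite ge_min lexx.
rewrite indicE mem_set//= in dens.
(* With the hole the density ratio is at most [1 - e / 2], below this threshold. *)
have /dens : nbhs 1%:E [set y : \bar R | ((1 - e / 4)%:E < y)%E].
  apply: open_nbhs_nbhs; split; first exact: open_ereal_gt_ereal.
  by rewrite /= lte_fin; lra.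
move=> [d /= d0 dP]; exists (d / 2); first by rewrite divr_gt0.
move=> s sd.
have [->|s0] := eqVneq s 0; first by exists 0; rewrite ?subrr ?normr0 ?mulr0 ?addr0.
apply: contrapT => noA.
have s0' : 0 < `|s| by rewrite normr_gt0.
have r0 : 0 < `|s| * 2 by lra.
have BB : ball (x + s) (e * `|s|) `<=` ball x (`|s| * 2).
  move=> y; rewrite /ball/= => yxs.
  rewrite (_ : x - y = (x + s - y) - s); last by ring.
  apply: le_lt_trans (ler_normB _ _) _; nra.
have AB : (A `&` ball x (`|s| * 2)) `<=` (ball x (`|s| * 2) `\` ball (x + s) (e * `|s|)).
  move=> y [Ay By]; split => //; apply: contra_not noA; rewrite /ball/= => yxs.
  exists (y - x); last by rewrite addrC subrK.
  by rewrite -normrN ltW//; move: yxs; congr (`|_| < _); ring.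
have : (mu (A `&` ball x (`|s| * 2)) <= (`|s| * 2 *+ 2 - e * `|s| *+ 2)%:E)%E.
  have mAI : measurable (A `&` ball x (`|s| * 2) : set R) := measurableI _ _ mA (measurable_ball _ _).
  apply: lebesgue_measure_ball_diff mAI (ltW r0) _ BB AB.
  by rewrite mulr_ge0 ?ltW.
have := dP (`|s| * 2); rewrite /ball/= sub0r normrN gtr0_norm// => /(_ _ r0) dP1.
have {}dP1 := dP1 _.
rewrite lebesgue_measure_ball ?ltW// in dP1.
move=> le1; have : ((1 - e / 4)%:E < (`|s| * 2 *+ 2 - e * `|s| *+ 2)%:E / (`|s| * 2 *+ 2)%:E)%E.
  apply: lt_le_trans (dP1 _) _; first by lra.
  by apply: lee_wpmul2r => //; rewrite inve_ge0 lee_fin mulrn_wge0// ltW.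
rewrite inver gt_eqF ?mulrn_wgt0// -EFinM lte_fin ltr_pdivlMr ?mulrn_wgt0//.
have es : 0 < e * `|s| by rewrite mulr_gt0.
by move: es; rewrite !mulr2n; clear => *; lra.
Qed.

End lipschitz_line.

(** * Null sets in R^n and their lines *)

Section null_sections.
Local Open Scope ereal_scope.
Context d1 d2 (T1 : measurableType d1) (T2 : measurableType d2) (R : realType).
Variables (m1 : {sigma_finite_measure set T1 -> \bar R})
          (m2 : {sigma_finite_measure set T2 -> \bar R}).

Lemma ge0_integral_null d (T : measurableType d) (m : {measure set T -> \bar R})
    (f : T -> \bar R) : measurable_fun setT f -> (forall x, 0 <= f x) ->
  \int[m]_x f x = 0 <-> m.-negligible [set x | f x <> 0].
Proof.
move=> mf f0; have := ae_eq_integral_abs m measurableT mf.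
under eq_integral do rewrite gee0_abs//.
move=> ->; split; apply: negligibleS => x /=; first by apply: contra_not => /(_ I).
by apply: contra_not => fx _.
Qed.

Lemma product_null_xsection (A : set (T1 * T2)) : measurable A ->
  (m1 \x m2) A = 0 <-> m1.-negligible [set x | m2 (xsection A x) <> 0].
Proof.
move=> mA; rewrite /product_measure1.
by apply: ge0_integral_null => [|x]; [exact: measurable_fun_xsection|exact: measure_ge0].
Qed.

Lemma null_xsection_ysection (A : set (T1 * T2)) : measurable A ->
  m1.-negligible [set x | m2 (xsection A x) <> 0] <->
  m2.-negligible [set y | m1 (ysection A y) <> 0].
Proof.
move=> mA; have mF := measurable_fun_xsection m2 mA; have mG := measurable_fun_ysection m1 mA.
have E := indic_fubini_tonelli m1 m2 mA.
rewrite (indic_fubini_tonelli_FE m2 mA) (indic_fubini_tonelli_GE m1 mA) in E.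
split=> /ge0_integral_null H; apply/ge0_integral_null => //; try by move=> ?; exact: measure_ge0.
- by rewrite -[LHS]E; apply: H => // x; exact: measure_ge0.
- by rewrite [LHS]E; apply: H => // x; exact: measure_ge0.
Qed.

(** Packages the product as a sigma-finite measure again, so that products with a line can be
    iterated in [euclidean_measure]. *)
Lemma product_sigma_finite :
  exists M : {sigma_finite_measure set (T1 * T2)%type -> \bar R},
    forall A, M A = (m1 \x m2) A.
Proof.
suff sf : sigma_finite setT (m1 \x m2).
  pose m := Measure_isSigmaFinite.Build _ _ _ (m1 \x m2) sf.
  by exists (HB.pack_for {sigma_finite_measure set (T1 * T2)%type -> \bar R} (m1 \x m2) m).
have /sigma_finiteP[F [FT Fnd Ffin]] := sigma_finiteT m1.
have /sigma_finiteP[G [GT Gnd Gfin]] := sigma_finiteT m2.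
exists (fun n => F n `*` G n) => [|n].
  apply/esym; rewrite -subTset => -[x y] _.
  have [i _ Fx] : (\bigcup_i F i) x by rewrite -FT.
  have [j _ Gy] : (\bigcup_i G i) y by rewrite -GT.
  exists (maxn i j) => //; split => /=.
    by have /subsetPset := Fnd _ _ (leq_maxl i j); apply.
  by have /subsetPset := Gnd _ _ (leq_maxr i j); apply.
have [mF Foo] := Ffin n; have [mG Goo] := Gfin n.
split; first exact: measurableX.
by rewrite product_measure1E// lte_mul_pinfty// ge0_fin_numE.
Qed.

End null_sections.

Section euclidean_null.
Context {R : realType}.
Local Notation lam := (@lebesgue_measure R).

Lemma lebesgue_setT_neq0 : lam setT <> 0%E.
Proof.
have E := lebesgue_measure_ball (0 : R) ler01.
move=> LT0; suff : (lam (ball (0%R : R) 1%R) <= lam setT)%E by rewrite LT0 E lee_fin leNgt ltr0n.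
exact: (le_measure lam (mem_set (measurable_ball (0:R) 1)) (mem_set measurableT) (@subsetT _ _)).
Qed.

(* A concrete model of n-dimensional Lebesgue measure, as an iterated product of
   measured lines: [co x i] is the i-th coordinate of [x], [tr v] the
   translation by [v]. *)
Lemma euclidean_measure (n : nat) :
  exists (d : measure_display) (T : measurableType d)
    (mu : {sigma_finite_measure set T -> \bar R})
    (co : T -> nat -> R) (tr : (nat -> R) -> T -> T),
    [/\ mu setT <> 0%E,
        forall i, measurable_fun setT (co ^~ i),
        forall v, measurable_fun setT (tr v),
        forall v x i, (i < n)%N -> co (tr v x) i = co x i + v i &
        forall v A, measurable A -> mu A = 0%E -> mu (tr v @^-1` A) = 0%E].
Proof.
elim: n => [|n [d [T [mu [co [tr [mu0 mco mtr cotr trnull]]]]]]].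
  exists _, unit, (dirac tt), (fun _ _ => 0), (fun _ x => x); split => //.
  by rewrite /= (diracT R tt); exact/eqP/oner_neq0.
pose L : {sigma_finite_measure set (measurableTypeR R) -> \bar R} := lam.
have [M ME] := product_sigma_finite mu L.
exists _, (T * measurableTypeR R)%type, M,
  (fun p i => if i == n then p.2 else co p.1 i),
  (fun v p => (tr v p.1, p.2 + v n)); split.
- rewrite ME => /(product_null_xsection mu L measurableT) muT; apply: mu0.
  apply: (measure_negligible measurableT); apply: negligibleS muT => x _ /=.
  have -> : xsection [set: T * measurableTypeR R] x = setT.
    by apply/seteqP; split => // y _; rewrite /xsection/= inE.
  exact: lebesgue_setT_neq0.
- move=> i; case: eqP => _; first exact: measurable_snd.
  exact: (measurableT_comp (mco i) measurable_fst).
- move=> v; apply/measurable_fun_pairP; split => /=.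
    exact: (measurableT_comp (mtr v) measurable_fst).
  by apply: measurable_funD => //; exact: measurable_snd.
- move=> v x i; rewrite ltnS leq_eqVlt => /predU1P[->|ilt]; first by rewrite eqxx.
  by rewrite ltn_eqF//= cotr.
move=> v A mA; rewrite !ME => /(product_null_xsection mu L mA) A0.
have mtr' : measurable_fun setT (fun p : T * measurableTypeR R => (tr v p.1, (p.2 + v n) : measurableTypeR R)).
  apply/measurable_fun_pairP; split => /=.
    exact: (measurableT_comp (mtr v) measurable_fst).
  by apply: measurable_funD => //; exact: measurable_snd.
have mpA : measurable ((fun p : T * measurableTypeR R => (tr v p.1, (p.2 + v n) : measurableTypeR R)) @^-1` A).
  by rewrite -[X in measurable X]setTI; exact: mtr'.
apply/(product_null_xsection mu L mpA).
(* A section of the translated set is a translate of the section at the translated base point. The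
   induction hypothesis takes care of the base points, [lebesgue_null_shift] of the sections. *)
have mN : measurable [set x | L (xsection A x) <> 0%E].
  have := emeasurable_neq measurableT (measurable_fun_xsection L mA) (0%E).
  by rewrite setTI; congr (measurable _); apply/seteqP; split => x /= /eqP.
exists (tr v @^-1` [set x | L (xsection A x) <> 0%E]); split.
- by rewrite -[X in measurable X]setTI; exact: mtr.
- by apply: trnull => //; exact: measure_negligible.
move=> x /=; apply: contra_not => A0x.
rewrite -(_ : (fun t => t + v n) @^-1` (xsection A (tr v x)) = xsection _ x).
  exact: lebesgue_null_shift.
by apply/seteqP; split => t; rewrite /xsection /= !inE.
Qed.

Lemma row_rat_dense n (z : 'rV[R]_n) (e : R) : 0 < e ->
  exists q : 'rV[rat]_n, `|z - map_mx ratr q| < e.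
Proof.
move=> e0.
have /choice[q qP] : forall i, exists q : rat, `|z ord0 i - ratr q| < e.
  move=> i; have [|q] := @rat_in_itvoo R (z ord0 i - e) (z ord0 i + e); first by lra.
  by rewrite in_itv/= => qi; exists q; rewrite ltr_distlC.
exists (\row_i q i); rewrite [`|_|]mx_normrE; apply/bigmax_ltP; split => // -[i j] _.
by rewrite !mxE ord1.
Qed.

(** Balls of the sup norm are boxes, so their preimages are measurable coordinate by coordinate, and
    an open set is a countable union of balls with rational centre and radius [1 / (k + 1)]. *)
Lemma borel_row_preimage d (S : measurableType d) n (g : S -> 'rV[R]_n) (E : set 'rV[R]_n) :
  (forall i, measurable_fun setT (fun x => g x ord0 i)) ->
  <<s open >> E -> measurable (g @^-1` E).
Proof.
move=> mg bE.
suff : [set E | measurable (g @^-1` E)] E by [].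
apply: bE; split.
  split => /=.
  - by rewrite preimage_set0.
  - by move=> A mA; rewrite setTD preimage_setC; exact: measurableC.
  - by move=> F mF; rewrite preimage_bigcup; exact: bigcupT_measurable.
move=> U oU /=.
have mball q (e : R) : 0 < e -> measurable (g @^-1` [set y | `|q - y| < e]).
  move=> e0.
  have -> : g @^-1` [set y | `|q - y| < e] =
      \bigcap_(i in [set: 'I_n]) ((fun x => g x ord0 i) @^-1` [set` `]q ord0 i - e, q ord0 i + e[]).
    apply/seteqP; split => x /=.
      rewrite [X in X < _]mx_normrE => /bigmax_ltP[_ H] i _ /=.
      by have := H (ord0, i) erefl; rewrite !mxE /= ltr_distlC in_itv.
    rewrite [X in X < _]mx_normrE => H; apply/bigmax_ltP; split => // -[i j] _ /=.
    by rewrite !mxE ord1 ltr_distlC; have := H j I; rewrite /= in_itv.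
  apply: fin_bigcap_measurable => [|i _]; first exact: finite_finset.
  by rewrite -[X in measurable X]setTI; apply: mg => //; exact: measurable_itv.
pose B (p : 'rV[rat]_n * nat) : set 'rV[R]_n := [set y | `|map_mx ratr p.1 - y| < p.2.+1%:R^-1].
have -> : U = \bigcup_p (if `[< B p `<=` U >] then B p else set0).
  apply/seteqP; split => [x Ux|x [p _]]; last by case: asboolP => // BU /BU.
  have /nbhs_ballP[e /= e0 eU] : nbhs x U by exact: open_nbhs_nbhs.
  have [k ke] : exists k : nat, k.+1%:R^-1 < e / 2.
    have e2 : 0 < e / 2 by lra.
    by have [k] := ltr_add_invr e2; rewrite add0r => kP; exists k.
  have k0 : 0 < k.+1%:R^-1 :> R by rewrite invr_gt0.
  have [q qx] := row_rat_dense x k0.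
  exists (q, k) => //; rewrite asboolT.
    by rewrite /B/= distrC.
  move=> y; rewrite /B/= => qy; apply: eU; rewrite -ball_normE /ball_ /=.
  rewrite -(subrK (map_mx ratr q) x) -addrA (le_lt_trans (ler_normD _ _))//.
  by rewrite [e]splitr; exact: lt_trans (ltrD qx qy) (ltrD ke ke).
rewrite preimage_bigcup; apply: countable_bigcupT_measurable => [|p].
  exact: countableP.
case: asboolP => _; last by rewrite preimage_set0.
by apply: mball; rewrite invr_gt0.
Qed.

(* [Nul] is the ideal of sets with null preimage in the model: Fubini along [u]
   gives the first property, and Fubini along [v], with translations of the model,
   gives the second. *)
Lemma null_lines (n : nat) : exists Nul : set (set 'rV[R]_n),
  [/\ forall (E : set 'rV[R]_n) (u : 'rV[R]_n), <<s open >> E ->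
        (forall x : 'rV[R]_n, lam.-negligible [set t | E (x + t *: u)]) -> Nul E,
      forall (E : set 'rV[R]_n) (v x : 'rV[R]_n) (e : R), <<s open >> E -> Nul E -> 0 < e ->
        exists2 x' : 'rV[R]_n, `|x' - x| < e & lam.-negligible [set t | E (x' + t *: v)],
      forall E F, Nul E -> Nul F -> Nul (E `|` F) &
      forall E F, F `<=` E -> Nul E -> Nul F].
Proof.
have [d [T [mu [co [tr [mu0 mco mtr cotr trnull]]]]]] := euclidean_measure n.
pose L : {sigma_finite_measure set (measurableTypeR R) -> \bar R} := lam.
pose e x : 'rV[R]_n := \row_i co x i.
pose ext (v : 'rV[R]_n) (i : nat) : R := if insub i is Some j then v ord0 j else 0.
have etr v x : e (tr (ext v) x) = e x + v.
  by apply/rowP => i; rewrite !mxE cotr// /ext valK.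
have me i : measurable_fun setT (fun x => e x ord0 i).
  by under eq_fun do rewrite mxE; exact: mco.
pose line (E : set 'rV[R]_n) v : set (T * measurableTypeR R) := [set p | E (e p.1 + p.2 *: v)].
have mline E v : <<s open >> E -> measurable (line E v).
  move=> bE; apply: (@borel_row_preimage _ _ _ (fun p : T * measurableTypeR R => e p.1 + (p.2 : R) *: v)) => // i.
  under eq_fun do rewrite !mxE.
  apply: measurable_funD; first exact: (measurableT_comp (mco i) measurable_fst).
  by apply: measurable_funM => //; exact: measurable_snd.
have meE E : <<s open >> E -> measurable (e @^-1` E) by exact: borel_row_preimage.
have xsE E v x : xsection (line E v) x = [set t | E (e x + t *: v)].
  by apply/seteqP; split => t; rewrite /xsection /line /= inE.
have ysE E v t : ysection (line E v) t = tr (ext (t *: v)) @^-1` (e @^-1` E).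
  by apply/seteqP; split => x; rewrite /ysection /line /= inE /= etr.
exists [set E | mu.-negligible (e @^-1` E)]; split => /=.
- move=> E u bE Enull.
  have : mu.-negligible [set x | L (xsection (line E u) x) <> 0%E].
    apply: negligibleS (negligible_set0 mu) => x /=; apply.
    apply: measure_negligible; first exact: measurable_xsection (mline _ _ bE).
    by rewrite xsE; exact: Enull.
  move=> /(null_xsection_ysection _ _ (mline _ _ bE)) Ly.
  (* One null translate of the preimage of [E] is enough, since translating it back preserves null
     sets. *)
  have [t /= Et] : exists t, mu (ysection (line E u) t) = 0%E.
    apply: contrapT => /forallNP H; apply: lebesgue_setT_neq0.
    apply: (measure_negligible measurableT).
    by apply: negligibleS Ly => t _; exact: H.
  apply/negligibleP; first exact: meE.
  have -> : e @^-1` E = tr (ext (- (t *: u))) @^-1` ysection (line E u) t.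
    apply/seteqP; split => x; rewrite ysE /= !etr subrK//.
  by apply: trnull => //; exact: measurable_ysection (mline _ _ bE).
- move=> E v x r bE Enull r0.
  have : L.-negligible [set t | mu (ysection (line E v) t) <> 0%E].
    apply: negligibleS (negligible_set0 L) => t /=; apply.
    rewrite ysE; apply: trnull; first exact: meE.
    exact: measure_negligible (meE _ bE) Enull.
  move=> /(null_xsection_ysection _ _ (mline _ _ bE)) Lx.
  apply: contrapT => /forall2NP noline.
  pose U := e @^-1` ball x r.
  have mU : measurable U by apply: meE; apply: sub_sigma_algebra; exact: ball_open.
  have U0 : mu U = 0%E.
    apply: (measure_negligible mU); apply: negligibleS Lx => y; rewrite /U -ball_normE /= => yx.
    move=> xs0; have [|] := noline (e y); first by apply; rewrite distrC.
    apply; apply/negligibleP; rewrite -xsE//; exact: measurable_xsection (mline _ _ bE).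
  (* The translates of [U] by rational vectors cover the whole space, so [U] cannot be null. *)
  pose W k := if unpickle k is Some q then tr (ext (map_mx ratr (q : 'rV[rat]_n))) @^-1` U else set0.
  apply: mu0; apply: (measure_negligible measurableT).
  have : mu.-negligible (\bigcup_k W k).
    apply: negligible_bigcup => k; rewrite /W; case: unpickle => [q|]; last exact: negligible_set0.
    by apply/negligibleP; [rewrite -[X in measurable X]setTI; exact: mtr|exact: trnull].
  apply: negligibleS => y _.
  have [q qP] := row_rat_dense (x - e y) r0.
  exists (pickle q) => //; rewrite /W pickleK /U /= etr -ball_normE /=.
  by rewrite opprD addrA.
- by move=> E F; rewrite preimage_setU; exact: negligibleU.
- by move=> E F FE; apply: negligibleS => x; exact: FE.
Qed.

End euclidean_null.

(** * Rademacher's theorem and the mean value inequality *)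

Section dot_product.
Context {R : realType}.

Lemma entry_le_norm m n (A : 'M[R]_(m, n)) i j : `|A i j| <= `|A|.
Proof.
rewrite [leRHS]mx_normrE; apply/bigmax_geP; right; exists (i, j) => //=.
Qed.

Lemma norm_le_entries m n (A : 'M[R]_(m, n)) (e : R) : 0 <= e ->
  (forall i j, `|A i j| <= e) -> `|A| <= e.
Proof.
by move=> e0 Ae; rewrite [leLHS]mx_normrE; apply/bigmax_leP; split => // -[i j] _; exact: Ae.
Qed.

(** The norm of ['rV[R]_n] is the sup norm; the Euclidean structure enters only through [dot], and
    each passage between the two costs a factor such as [n%:R]. *)
Definition dot n (u v : 'rV[R]_n) : R := \sum_i u ord0 i * v ord0 i.

Lemma dotC n (u v : 'rV[R]_n) : dot u v = dot v u.
Proof. by apply: eq_bigr => i _; rewrite mulrC. Qed.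

Lemma dotDl n (u v w : 'rV[R]_n) : dot (u + v) w = dot u w + dot v w.
Proof. by rewrite /dot -big_split; apply: eq_bigr => i _; rewrite mxE mulrDl. Qed.

Lemma dotDr n (u v w : 'rV[R]_n) : dot u (v + w) = dot u v + dot u w.
Proof. by rewrite dotC dotDl !(dotC u). Qed.

Lemma dotZl n a (u v : 'rV[R]_n) : dot (a *: u) v = a * dot u v.
Proof. by rewrite /dot mulr_sumr; apply: eq_bigr => i _; rewrite mxE mulrA. Qed.

Lemma dotZr n a (u v : 'rV[R]_n) : dot u (a *: v) = a * dot u v.
Proof. by rewrite dotC dotZl dotC. Qed.

Lemma dotNl n (u v : 'rV[R]_n) : dot (- u) v = - dot u v.
Proof. by rewrite -scaleN1r dotZl mulN1r. Qed.

Lemma dotNr n (u v : 'rV[R]_n) : dot u (- v) = - dot u v.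
Proof. by rewrite dotC dotNl dotC. Qed.

Lemma dot0l n (v : 'rV[R]_n) : dot 0 v = 0.
Proof. by rewrite -(scale0r v) dotZl mul0r. Qed.

Lemma dotBr n (u v w : 'rV[R]_n) : dot u (v - w) = dot u v - dot u w.
Proof. by rewrite dotDr dotNr. Qed.

Lemma dotBl n (u v w : 'rV[R]_n) : dot (u - v) w = dot u w - dot v w.
Proof. by rewrite dotDl dotNl. Qed.

Lemma dot_delta n (u : 'rV[R]_n) i : dot u (delta_mx ord0 i) = u ord0 i.
Proof.
rewrite /dot (bigD1 i)//= big1 ?addr0 => [|j ji]; first by rewrite mxE !eqxx mulr1.
by rewrite mxE (negPf ji) andbF mulr0.
Qed.

Lemma normr_dot_le n (u v : 'rV[R]_n) : `|dot u v| <= n%:R * `|u| * `|v|.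
Proof.
apply: le_trans (ler_norm_sum _ _ _) _.
apply: (@le_trans _ _ (\sum_(i < n) `|u| * `|v|)).
  by apply: ler_sum => i _; rewrite normrM ler_pM// entry_le_norm.
by rewrite sumr_const card_ord -[leLHS]mulr_natl mulrA.
Qed.

Lemma sqr_norm_le_dot n (u : 'rV[R]_n) : `|u| ^+ 2 <= dot u u.
Proof.
have dotuu : 0 <= dot u u by apply: sumr_ge0 => i _; rewrite -expr2 sqr_ge0.
suff : `|u| <= Num.sqrt (dot u u).
  by move=> h; rewrite -(sqr_sqrtr dotuu); apply: ler_pM => //.
apply: norm_le_entries => [|i j]; first exact: sqrtr_ge0.
rewrite ord1 -sqrtr_sqr ler_wsqrtr// /dot (bigD1 j)//= -expr2 lerDl.
by apply: sumr_ge0 => k _; rewrite -expr2 sqr_ge0.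
Qed.

Lemma norm_delta_mx n (i : 'I_n) : `|delta_mx ord0 i : 'rV[R]_n| = 1.
Proof.
apply/eqP; rewrite eq_le; apply/andP; split.
  by apply: norm_le_entries => // a b; rewrite mxE; case: (_ && _); rewrite ?normr1 ?normr0.
by apply: le_trans (entry_le_norm _ ord0 i); rewrite mxE !eqxx normr1.
Qed.

End dot_product.

Section differentiable_bound.
Context {R : realType}.

Lemma norm_mulmx_le k m n (A : 'M[R]_(k, m)) (B : 'M[R]_(m, n)) :
  `|A *m B| <= m%:R * `|A| * `|B|.
Proof.
apply: norm_le_entries => [|i j]; first by rewrite !mulr_ge0.
rewrite mxE; apply: le_trans (ler_norm_sum _ _ _) _.
apply: (@le_trans _ _ (\sum_(i < m) `|A| * `|B|)).
  by apply: ler_sum => l _; rewrite normrM ler_pM// entry_le_norm.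
by rewrite sumr_const card_ord -[leLHS]mulr_natl mulrA.
Qed.

Lemma differentiable_bound n m (f : 'rV[R]_n -> 'rV[R]_m) (x : 'rV[R]_n) (A : 'M[R]_(n, m)) :
  (forall e : R, 0 < e -> exists2 d : R, 0 < d &
    forall h : 'rV[R]_n, `|h| < d -> `|f (x + h) - f x - h *m A| <= e * `|h|) ->
  differentiable f x.
Proof.
move=> fA; pose df : {linear 'rV[R]_n -> 'rV[R]_m} := mulmxr A.
have dfc : continuous df.
  apply: (@lipschitz_bound_continuous _ _ _ _ (n%:R * `|A|)) => y z.
  rewrite /df /= -mulmxBl (le_trans (norm_mulmx_le _ _))//.
  by rewrite mulrAC.
have o : f \o shift x = cst (f x) + df +o_ (0 : 'rV[R]_n) id.
  apply/eqaddoP => e e0; have [d d0 dP] := fA e e0.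
  apply/nbhs_ballP; exists d => //= h; rewrite -ball_normE /= sub0r normrN => /dP.
  move=> H; suff : `|f (h + x) - (f x + df h)| <= e * `|h| by [].
  by rewrite opprD addrA [h + x]addrC.
by apply/diff_locallyP; rewrite (diff_unique dfc o).
Qed.

Lemma jacobian_bound n m (f : 'rV[R]_n -> 'rV[R]_m) (x : 'rV[R]_n) :
  differentiable f x -> forall e : R, 0 < e ->
    exists2 d : R, 0 < d & forall h : 'rV[R]_n, `|h| < d -> `|f (x + h) - f x - h *m 'J f x| <= e * `|h|.
Proof.
move=> df e e0; have [_] := (diff_locallyP _ _).1 df.
move=> /eqaddoP /(_ e e0) /nbhs_ballP[d /= d0 dP]; exists d => // h hd.
have := dP h; rewrite -ball_normE /= sub0r normrN => /(_ hd).
move=> H; have {}H : `|f (h + x) - (f x + 'd f x h)| <= e * `|h| := H.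
by rewrite mul_rV_lin1 -addrA -opprD [x + h]addrC.
Qed.

Lemma is_derive_bound (phi : R -> R) (t c : R) : is_derive t (1 : R) phi c ->
  forall e : R, 0 < e -> exists2 d : R, 0 < d &
    forall s : R, `|s| < d -> `|phi (t + s) - phi t - s * c| <= e * `|s|.
Proof.
move=> [dphi <-] e e0.
have /eqaddoP /(_ e e0) /nbhs_ballP[d /= d0 dP] := derivable_nbhs dphi.
exists d => // s sd.
have := dP s; rewrite -ball_normE /= sub0r normrN => /(_ sd).
move=> H; have {}H : `|phi (s *: 1 + t) - (phi t + s * 'D_1 phi t)| <= e * `|s| := H.
by move: H; rewrite [s *: 1]mulr1 [s + t]addrC opprD addrA.
Qed.

End differentiable_bound.

(** The limit is the supremum of the lower ends [b k - 1 / (k + 1)], for which every upper end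
    [b l + 1 / (l + 1)] is an upper bound. *)
Lemma bounded_error_limit (R : realType) (b : nat -> R) :
  (forall k l, `|b k - b l| <= k.+1%:R^-1 + l.+1%:R^-1) ->
  exists s, forall k, `|s - b k| <= k.+1%:R^-1.
Proof.
move=> bP; pose A := [set b k - k.+1%:R^-1 | k in [set: nat]].
have A0 : A !=set0 by exists (b 0%N - 1%:R^-1); exists 0%N.
have ubA l : ubound A (b l + l.+1%:R^-1).
  move=> _ [k _ <-]; have := bP k l; rewrite ler_norml => /andP[_].
  by move: k.+1%:R^-1 l.+1%:R^-1 => *; lra.
exists (sup A) => k; rewrite ler_distl; apply/andP; split.
  by apply: ub_le_sup; [exists (b k + k.+1%:R^-1)|exists k].
exact: ge_sup.
Qed.

Section rademacher.
Context {R : realType} (n : nat).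
Variables (g : 'rV[R]_n -> R) (L : R).
Hypothesis lipg : forall x y, `|g x - g y| <= L * `|x - y|.
Local Notation lam := (@lebesgue_measure R).

(* [x] admits the linear approximation [a] along the span of the first [j] basis
   vectors, with relative error [1/(k+1)] on the ball of radius [1/(m+1)]. *)
Definition approx_grad j (a : 'rV[R]_n) (k m : nat) (x : 'rV[R]_n) : Prop :=
  forall h : 'rV[R]_n, (forall i : 'I_n, (j <= i)%N -> h ord0 i = 0) -> `|h| <= m.+1%:R^-1 ->
    `|g (x + h) - g x - dot h a| <= k.+1%:R^-1 * `|h|.

(** The gradient is rational and may vary with [k], which makes the set a countable intersection of
    countable unions of closed sets, hence Borel. The true gradient reappears as a limit in
    [partially_diff_gradient]. *)
Definition partially_diff j : set 'rV[R]_n :=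
  [set x | forall k, exists p : 'rV[rat]_n * nat, approx_grad j (map_mx ratr p.1) k p.2 x].

Lemma closed_approx_grad j a k m : closed [set x | approx_grad j a k m x].
Proof.
have -> : [set x | approx_grad j a k m x] =
    \bigcap_(h in [set h : 'rV[R]_n | (forall i : 'I_n, (j <= i)%N -> h ord0 i = 0) /\ `|h| <= m.+1%:R^-1])
      ((fun x => `|g (x + h) - g x - dot h a|) @^-1` [set y | y <= k.+1%:R^-1 * `|h|]).
  by apply/seteqP; split => x H h => [[]|h1 h2]; [exact: H|exact: (H h (conj h1 h2))].
apply: closed_bigI => h _; apply: closed_comp; last exact: closed_le.
move=> x _; apply: (@lipschitz_bound_continuous _ 'rV[R]_n _ _ (L + L)) => {}x y.
apply: le_trans (ler_dist_dist _ _) _.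
rewrite (_ : _ - _ - (_ - _ - _) = (g (x + h) - g (y + h)) - (g x - g y)); last by ring.
apply: le_trans (ler_normB _ _) _; rewrite mulrDl lerD//.
by apply: le_trans (lipg _ _) _; rewrite opprD addrACA subrr addr0.
Qed.

Lemma borel_partially_diff j : <<s open >> (partially_diff j).
Proof.
have -> : partially_diff j = \bigcap_k \bigcup_p [set x | approx_grad j (map_mx ratr p.1) k p.2 x].
  apply/seteqP; split => x H k; first by move=> _; have [p pP] := H k; exists p.
  by have [p _ pP] := H k I; exists p.
suff : measurable (\bigcap_k \bigcup_p [set x | approx_grad j (map_mx ratr p.1) k p.2 x]
    : set (g_sigma_algebraType (@open 'rV[R]_n))) by [].
apply: bigcapT_measurable => k; apply: countable_bigcupT_measurable => [|p].
  exact: countableP.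
rewrite -[X in measurable X]setCK; apply: measurableC; apply: sub_sigma_algebra.
by apply: closed_openC; exact: closed_approx_grad.
Qed.

(** The inductive step of Rademacher's theorem. Write [h = h' + s *: u]. At points of the line
    arbitrarily close to [x + s *: u], relative to [|s|], the first [j] variables are controlled by
    one gradient on one radius. Lipschitz continuity pays for replacing [s] by such an [s'], and the
    derivative [c] along the line leads back to [x]; so the new gradient is the old one with its
    [j]-th entry replaced by [c]. *)
Lemma approx_grad_extend (j : 'I_n) (x : 'rV[R]_n) (c : R) :
  let u := delta_mx ord0 j in
  (forall e : R, 0 < e -> exists2 d : R, 0 < d &
    forall s : R, `|s| < d -> `|g (x + s *: u) - g x - s * c| <= e * `|s|) ->
  (forall k, exists p : 'rV[rat]_n * nat, forall e : R, 0 < e ->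
    exists2 d : R, 0 < d & forall s : R, `|s| < d ->
    exists2 s' : R, `|s' - s| <= e * `|s| & approx_grad j (map_mx ratr p.1) k p.2 (x + s' *: u)) ->
  partially_diff j.+1 x.
Proof.
move=> u dphi dens k.
have L0 : 0 <= L.
  have := le_trans (normr_ge0 _) (lipg u 0).
  by rewrite subr0 norm_delta_mx mulr1.
pose eta : R := k.+1%:R^-1 / 2.
have k1 : k.+1%:R^-1 <= 1 :> R by rewrite invf_le1// ler1n.
have eta0 : 0 < eta by rewrite /eta divr_gt0 ?invr_gt0.
(* The errors [T1] to [T4] below add up to at most [e * C * |h| = eta * |h|]; the other half of
   [1 / (k + 1)] pays for rounding the gradient to a rational one. *)
pose C := L + 4 + `|c|.
have C4 : 4 <= C by rewrite /C; have := normr_ge0 c; lra.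
pose e := eta / C.
have e0 : 0 < e by rewrite /e divr_gt0//; lra.
have eC : e * C = eta by rewrite /e divfK//; apply/eqP; lra.
have eta1 : eta <= 1 / 2 by rewrite /eta; move: k1; generalize (k.+1%:R^-1 : R) => ?; lra.
have e1 : e <= 1.
  have : e * 4 <= e * C by rewrite ler_wpM2l// ltW.
  by move: eta1; rewrite eC; clear; lra.
have [k' k'e] : exists k' : nat, k'.+1%:R^-1 < e.
  by have [k'] := ltr_add_invr e0; rewrite add0r => k'P; exists k'.
have [[p m0] /= /(_ e e0)[d2 d20 dens2]] := dens k'.
have [d1 d10 dphi1] := dphi e e0.
set a : 'rV[R]_n := map_mx ratr p in dens2.
pose a' := a + (c - a ord0 j) *: u.
have n0 : 0 < n%:R :> R by rewrite ltr0n; exact: leq_ltn_trans (ltn_ord j).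
have en0 : 0 < eta / n%:R by rewrite divr_gt0.
have [q qP] := row_rat_dense a' en0.
have [m mP] : exists m : nat, m.+1%:R^-1 < Num.min (d1 / 2) (Num.min d2 m0.+1%:R^-1).
  have : 0 < Num.min (d1 / 2) (Num.min d2 m0.+1%:R^-1) by rewrite !lt_min divr_gt0//= d20/= invr_gt0.
  by move=> /ltr_add_invr[m]; rewrite add0r => mP; exists m.
exists (q, m) => /= h hj hm.
move: mP; rewrite !lt_min => /and3P[md1 md2 mm0].
pose s := h ord0 j.
pose h' := h - s *: u.
have sh : `|s| <= `|h| by exact: entry_le_norm.
have hE : h = h' + s *: u by rewrite subrK.
have h'i i : h' ord0 i = if i == j then 0 else h ord0 i.
  rewrite !mxE eqxx /=; case: eqVneq => [->|_]; first by rewrite mulr1 subrr.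
  by rewrite mulr0 subr0.
have h'j (i : 'I_n) : (j <= i)%N -> h' ord0 i = 0.
  rewrite h'i; case: eqVneq => // ij ji; apply: hj.
  by rewrite ltn_neqAle ji andbT eq_sym.
have h'h : `|h'| <= `|h|.
  apply: norm_le_entries => // i0 i; rewrite ord1 h'i; case: ifP; rewrite ?normr0// => _.
  exact: entry_le_norm.
have sd2 : `|s| < d2 by apply: le_lt_trans (le_trans sh hm) md2.
have [s' s's apx] := dens2 s sd2.
have s'2 : `|s'| <= 2 * `|s|.
  rewrite -(subrK s s'); apply: le_trans (ler_normD _ _) _.
  by apply: le_trans (lerD s's (lexx _)) _; have := normr_ge0 s; nra.
have s'd1 : `|s'| < d1.
  apply: le_lt_trans s'2 _; rewrite -ltr_pdivlMl// mulrC.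
  exact: le_lt_trans (le_trans sh hm) md1.
have T2 := apx h' h'j (le_trans h'h (le_trans hm (ltW mm0))).
have T3 := dphi1 s' s'd1.
have T1 : `|g (x + h) - g (x + s' *: u + h')| <= L * `|s - s'|.
  apply: le_trans (lipg _ _) _; rewrite {1}hE.
  rewrite (_ : x + (h' + s *: u) - (x + s' *: u + h') = (s - s') *: u).
    by rewrite normrZ norm_delta_mx mulr1.
  by apply/rowP => i; rewrite !mxE; ring.
have T5 : `|dot h (a' - map_mx ratr q)| <= eta * `|h|.
  apply: le_trans (normr_dot_le _ _) _.
  rewrite mulrAC ler_wpM2r// -ler_pdivlMl// mulrC.
  exact: ltW.
have dotE : dot h (map_mx ratr q) = dot h' a + s * c - dot h (a' - map_mx ratr q).
  have dha : dot h a = dot h' a + s * a ord0 j.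
    by rewrite {1}hE dotDl dotZl (dotC u) dot_delta.
  by rewrite dotBr /a' dotDr dotZr dot_delta dha -/s; ring.
rewrite dotE (_ : _ - _ - _ = (g (x + h) - g (x + s' *: u + h'))
  + (g (x + s' *: u + h') - g (x + s' *: u) - dot h' a)
  + (g (x + s' *: u) - g x - s' * c) + (s' - s) * c + dot h (a' - map_mx ratr q)); last by ring.
have T4 : `|(s' - s) * c| <= e * `|s| * `|c| by rewrite normrM ler_wpM2r.
have T1' : L * `|s - s'| <= L * (e * `|s|) by rewrite ler_wpM2l// distrC.
have T2' : k'.+1%:R^-1 * `|h'| <= e * `|h| by rewrite ler_pM// ltW.
have T3' : e * `|s'| <= e * (2 * `|s|) by rewrite ler_wpM2l// ltW.
apply: (@le_trans _ _ (L * (e * `|s|) + e * `|h| + e * (2 * `|s|) + e * `|s| * `|c| + eta * `|h|)).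
  apply: le_trans (ler_normD _ _) (lerD _ T5); apply: le_trans (ler_normD _ _) (lerD _ T4).
  apply: le_trans (ler_normD _ _) (lerD _ (le_trans T3 T3')).
  exact: le_trans (ler_normD _ _) (lerD (le_trans T1 T1') (le_trans T2 T2')).
have -> : k.+1%:R^-1 = eta + e * C by rewrite eC /eta -splitr.
have : e * `|s| * (L + 2 + `|c|) <= e * `|h| * (L + 2 + `|c|).
  by rewrite ler_wpM2r ?ler_wpM2l ?addr_ge0// ltW.
have := normr_ge0 h; move: e0; rewrite /C; clear.
move: `|s| `|h| `|c| => S H c'; nra.
Qed.

(** Almost every [t] is a point of derivability of [g] along the line and, for each of the countably
    many sets [S q] that contain it, a point that [S q] approximates as in [density_point_near]. At
    such [t], [approx_grad_extend] applies. *)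
Lemma partially_diff_line (j : 'I_n) (x : 'rV[R]_n) :
  lam.-negligible [set t | (partially_diff j `\` partially_diff j.+1) (x + t *: delta_mx ord0 j)].
Proof.
set u := delta_mx ord0 j.
pose phi t := g (x + t *: u).
have lipphi s t : `|phi s - phi t| <= L * `|s - t|.
  apply: le_trans (lipg _ _) _.
  by rewrite opprD addrACA subrr add0r -scalerBl normrZ norm_delta_mx mulr1.
pose S (q : nat * ('rV[rat]_n * nat)) : set R := [set t | approx_grad j (map_mx ratr q.2.1) q.1 q.2.2 (x + t *: u)].
have mS q : measurable (S q).
  apply: closed_measurable.
  apply: (@closed_comp _ _ (fun t : R => x + t *: u)
    [set y | approx_grad j (map_mx ratr q.2.1) q.1 q.2.2 y]); last exact: closed_approx_grad.
  move=> t _; apply: (@lipschitz_bound_continuous _ _ 'rV[R]_n _ 1) => {}t s.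
  by rewrite opprD addrACA subrr add0r -scalerBl normrZ norm_delta_mx mulr1 mul1r.
pose N q := [set t | S q t /\ ~ forall e, 0 < e ->
    exists2 d, 0 < d & forall s, `|s| < d -> exists2 s', `|s' - s| <= e * `|s| & S q (t + s')].
have N0 q : lam.-negligible (N q) by exact: density_point_near.
have : lam.-negligible (\bigcup_k (if unpickle k is Some q then N q else set0)).
  apply: negligible_bigcup => k; case: unpickle => [q|]; last exact: negligible_set0.
  exact: N0.
move=> /(negligibleU (lipschitz_ae_derivable lipphi)).
apply: negligibleS => t /= [Dj Dj1]; apply: contrapT => /not_orP[/contrapT dphi Nt].
apply: Dj1; apply: (approx_grad_extend (c := 'D_1 phi t)).
  move=> e e0; have [d d0 dP] := is_derive_bound (DeriveDef dphi erefl) e0.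
  exists d => // s /dP; rewrite /phi scalerDl addrA; exact.
move=> k; have [p pP] := Dj k; exists p => e e0.
have [d d0 dP] : exists2 d, 0 < d & forall s, `|s| < d -> exists2 s', `|s' - s| <= e * `|s| & S (k, p) (t + s').
  apply: contrapT => H; apply: Nt; exists (pickle (k, p)) => //; rewrite pickleK; split => //.
  by move=> /(_ e e0).
exists d => // s /dP[s' s's Ss']; exists s' => //.
by move: Ss'; rewrite /S /= scalerDl addrA.
Qed.

Lemma partially_diffT x : partially_diff 0 x.
Proof.
move=> k; exists (0, 0%N) => h h0 _.
have -> : h = 0 by apply/rowP => i; rewrite mxE h0.
by rewrite addr0 dot0l subr0 subrr !normr0 mulr0.
Qed.

(** Testing two approximations on a multiple of a basis vector, at a radius valid for both, bounds
    the difference of their entries by the sum of their errors; hence the rational gradients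
    converge entrywise. *)
Lemma partially_diff_gradient x : partially_diff n x ->
  exists a : 'rV[R]_n, forall e : R, 0 < e -> exists2 d : R, 0 < d &
    forall h : 'rV[R]_n, `|h| < d -> `|g (x + h) - g x - dot h a| <= e * `|h|.
Proof.
move=> Dx; have /choice[p pP] := Dx.
pose b k : 'rV[R]_n := map_mx ratr (p k).1.
have bk (i : 'I_n) k l : `|b k ord0 i - b l ord0 i| <= k.+1%:R^-1 + l.+1%:R^-1.
  pose r : R := Num.min (p k).2.+1%:R^-1 (p l).2.+1%:R^-1.
  have r0 : 0 < r by rewrite lt_min !invr_gt0 !ltr0n.
  pose h : 'rV[R]_n := r *: delta_mx ord0 i.
  have hr : `|h| = r by rewrite normrZ norm_delta_mx mulr1 gtr0_norm.
  have V (i' : 'I_n) : (n <= i')%N -> h ord0 i' = 0 by rewrite leqNgt ltn_ord.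
  have := pP k h V; have := pP l h V; rewrite hr ge_min lexx orbT => /(_ erefl) Hl.
  rewrite ge_min lexx => /(_ erefl) Hk.
  have := le_trans (ler_normB _ _) (lerD Hl Hk).
  rewrite -mulrDl (_ : _ - _ - (_ - _ - _) = r * (b k ord0 i - b l ord0 i)).
    by rewrite normrM (gtr0_norm r0) mulrC ler_pM2r// [X in _ <= X -> _]addrC.
  by rewrite /h !dotZl !(dotC (delta_mx _ _)) !dot_delta /b; ring.
have /choice[a aP] : forall i : 'I_n, exists s, forall k, `|s - b k ord0 i| <= k.+1%:R^-1.
  by move=> i; apply: (@bounded_error_limit R (fun k => b k ord0 i)) => k l; exact: bk.
exists (\row_i a i) => e e0.
have n1 : 0 < n%:R + 1 :> R by rewrite ltr_wpDl.
have e0' : 0 < e / (n%:R + 1) by rewrite divr_gt0.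
have [k] := ltr_add_invr e0'; rewrite add0r => ke.
exists (p k).2.+1%:R^-1 => [|h hd]; first by rewrite invr_gt0.
have V (i' : 'I_n) : (n <= i')%N -> h ord0 i' = 0 by rewrite leqNgt ltn_ord.
have H := pP k h V (ltW hd).
rewrite (_ : _ - _ - _ = (g (x + h) - g x - dot h (b k)) + dot h (b k - \row_i a i)); last first.
  by rewrite dotBr; ring.
apply: le_trans (ler_normD _ _) _; apply: le_trans (lerD H (normr_dot_le _ _)) _.
have ba : `|b k - \row_i a i| <= k.+1%:R^-1.
  by apply: norm_le_entries => // i0 i; rewrite ord1 !mxE distrC; have := aP i k; rewrite mxE.
apply: (@le_trans _ _ (k.+1%:R^-1 * `|h| + n%:R * `|h| * k.+1%:R^-1)).
  by rewrite lerD2l ler_wpM2l// mulr_ge0.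
rewrite (_ : _ + _ = (k.+1%:R^-1 * (n%:R + 1)) * `|h|); last by ring.
by rewrite ler_wpM2r// -ler_pdivlMr// ltW.
Qed.

End rademacher.

Section mean_value.
Context {R : realType} (n : nat).
Local Notation lam := (@lebesgue_measure R).

(** The segment from [x] to [x + v] may consist of points where [f] is not differentiable. It is
    moved to a parallel segment from a nearby [x'] that meets the bad set [E] in a null set; there
    the one-variable inequality applies, and Lipschitz continuity transfers it back up to [e]. *)
Lemma lipschitz_mean_value (f : 'rV[R]_n -> 'rV[R]_n) (L : R) (x0 : 'rV[R]_n) (r : R)
    (v w : 'rV[R]_n) (c : R) :
  0 <= L -> (forall x y, `|f x - f y| <= L * `|x - y|) ->
  (forall z : 'rV[R]_n, `|z - x0| < r -> differentiable f z -> c <= dot w (v *m 'J f z)) ->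
  forall x : 'rV[R]_n, `|x - x0| < r -> `|x + v - x0| < r -> c <= dot w (f (x + v) - f x).
Proof.
move=> L0 lipf cJ x xr xvr.
have [Nul [NulA NulB NulU NulS]] := @null_lines R n.
pose g i x := f x ord0 i.
have lipg i y z : `|g i y - g i z| <= L * `|y - z|.
  apply: le_trans (lipf y z); rewrite /g.
  by rewrite (_ : _ - _ = (f y - f z) ord0 i) ?entry_le_norm// !mxE.
pose D i j := partially_diff (g i) j.
have bD i j : <<s open >> (D i j) by exact: borel_partially_diff (lipg i) j.
pose Bor := g_sigma_algebraType (@open 'rV[R]_n).
have mD i j : measurable (D i j : set Bor) by exact: bD.
(* Rademacher's theorem, one variable at a time: the points lost in passing from [j] to [j.+1] form
   a null set on every line in the direction of the [j]-th basis vector. *)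
have nulD i j : (j <= n)%N -> Nul (~` D i j).
  elim: j => [_|j IH jn].
    have -> : ~` D i 0 = set0 by apply/seteqP; split => // y; apply; exact: partially_diffT.
    apply: (NulA _ 0); first by apply: (@measurable0 _ Bor).
    by move=> y; exact: negligible_set0.
  apply: (NulS (~` D i j `|` (D i j `\` D i j.+1))).
    by move=> y nDy; have [Dy|] := pselect (D i j y); [right|left].
  apply: NulU; first exact: IH (ltnW jn).
  apply: (NulA _ (delta_mx ord0 (Ordinal jn))).
    by have : measurable ((D i j `\` D i j.+1) : set Bor) by exact: measurableD.
  by move=> y; exact: (partially_diff_line (lipg i) (Ordinal jn) y).
pose E := \bigcup_(i in [set: 'I_n]) ~` D i n.
have bE : <<s open >> E.
  suff : measurable (E : set Bor) by [].
  by apply: fin_bigcup_measurable => [|i _]; [exact: finite_finset|exact: measurableC].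
have nulE : Nul E.
  have -> : E = \big[setU/set0]_(i < n) ~` D i n.
    by rewrite /E -bigcup_seq_cond; apply/seteqP; split => z [i _ ?]; exists i => //=; rewrite mem_index_enum.
  elim/big_ind : _ => //; last by move=> i _; exact: nulD.
  by apply: (NulA _ 0) => [|y]; [exact: (@measurable0 _ Bor)|exact: negligible_set0].
have Ediff z : ~ E z -> differentiable f z.
  move=> nEz.
  have /choice[a aP] : forall i, exists a : 'rV[R]_n, forall e : R, 0 < e -> exists2 d : R, 0 < d &
      forall h : 'rV[R]_n, `|h| < d -> `|g i (z + h) - g i z - dot h a| <= e * `|h|.
    move=> i; apply: partially_diff_gradient.
    by apply: contrapT => nD; apply: nEz; exists i.
  apply: (@differentiable_bound _ _ _ _ _ (\matrix_(i, j) a j ord0 i)) => e e0.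
  have /choice[d dP] : forall i, exists d : R, 0 < d /\
      forall h : 'rV[R]_n, `|h| < d -> `|g i (z + h) - g i z - dot h (a i)| <= e * `|h|.
    by move=> i; have [d d0 dP] := aP i e e0; exists d.
  exists (\big[Num.min/1]_i d i).
    by apply/bigmin_gtP; split => // i _; have [] := dP i.
  move=> h hd; apply: norm_le_entries => [|i0 i]; first by rewrite mulr_ge0// ltW.
  have [_ /(_ h)] := dP i.
  have <- : (h *m \matrix_(i, j) a j ord0 i) ord0 i = dot h (a i).
    by rewrite mxE; apply: eq_bigr => k _; rewrite mxE.
  rewrite (ord1 i0) /g; move: (h *m _) => M; rewrite !mxE.
  by apply; apply: lt_le_trans hd _; exact: bigmin_le.
apply/ler_addgt0Pr => e e0.
(* Moving both ends of the segment by [x' - x] changes [dot w (f (x + v) - f x)] by at most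
   [n%:R * |w| * (L + L) * |x' - x|]; the [1] keeps [K] positive. *)
pose K := n%:R * `|w| * (L + L) + 1.
have K0 : 0 < K by rewrite ltr_wpDl// !mulr_ge0// addr_ge0.
have d0 : 0 < Num.min (e / K) (Num.min (r - `|x - x0|) (r - `|x + v - x0|)).
  by rewrite !lt_min divr_gt0//= !subr_gt0 xr.
have [x' x'x x'line] := NulB E v x _ bE nulE d0.
move: x'x; rewrite !lt_min => /and3P[x'e x'r x'vr].
pose phi t := dot w (f (x' + t *: v)).
have lipphi s t : `|phi s - phi t| <= (n%:R * `|w| * L * `|v|) * `|s - t|.
  rewrite /phi -dotBr; apply: le_trans (normr_dot_le _ _) _.
  rewrite -!mulrA !ler_wpM2l//; apply: le_trans (lipf _ _) _.
  by rewrite opprD addrACA subrr add0r -scalerBl normrZ [`|v| * _]mulrC.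
have seg t : 0 < t < 1 -> `|x' + t *: v - x0| < r.
  move=> /andP[t0 t1].
  have -> : x' + t *: v - x0 = (1 - t) *: (x' - x0) + t *: (x' + v - x0).
    by apply/rowP => i; rewrite !mxE; ring.
  have A1 : `|x' - x0| < r.
    rewrite (_ : x' - x0 = (x' - x) + (x - x0)); last by rewrite addrA subrK.
    by apply: le_lt_trans (ler_normD _ _) _; rewrite -ltrBrDr.
  have A2 : `|x' + v - x0| < r.
    rewrite (_ : x' + v - x0 = (x' - x) + (x + v - x0)); last by apply/rowP => i; rewrite !mxE; ring.
    by apply: le_lt_trans (ler_normD _ _) _; rewrite -ltrBrDr.
  apply: le_lt_trans (ler_normD _ _) _; rewrite !normrZ !gtr0_norm ?subr_gt0//.
  by clear -A1 A2 t0 t1; nra.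
have : c * (1 - 0) <= phi 1 - phi 0.
  apply: (lipschitz_increment_ge ler01 lipphi x'line) => t d t01 nEt dphi.
  have df := Ediff _ nEt.
  have := cJ _ (seg t t01) df.
  set q := dot w _.
  (* Both numbers are slopes of [phi] at [t], one through the Jacobian of [f] and one by hypothesis;
     the two first-order expansions are compared at a small step [s]. *)
  suff -> : q = d by [].
  apply/eqP; rewrite -subr_eq0 -normr_le0; apply/ler_addgt0Pr => e1 e10; rewrite add0r.
  pose B := n%:R * `|w| * `|v| + 1.
  have B0 : 0 < B by rewrite ltr_wpDl// !mulr_ge0.
  have e10' : 0 < e1 / (B + B) by rewrite divr_gt0// addr_gt0.
  have [d1 d10 d1P] := jacobian_bound df e10'.
  have e1h : 0 < e1 / 2 by rewrite divr_gt0.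
  have [d2 d20 d2P] := is_derive_bound dphi e1h.
  pose s : R := Num.min (d2 / 2) (d1 / 2 / (`|v| + 1)).
  have v1 : 0 < `|v| + 1 by rewrite ltr_wpDl.
  have s0 : 0 < s by rewrite lt_min !divr_gt0.
  have sd2 : `|s| < d2 by rewrite gtr0_norm// gt_min; apply/orP; left; lra.
  have svd1 : `|s *: v| < d1.
    rewrite normrZ gtr0_norm//; apply: (@le_lt_trans _ _ (d1 / 2 / (`|v| + 1) * (`|v| + 1))).
      apply: ler_pM => //; first exact: ltW.
        by rewrite ge_min lexx orbT.
      by rewrite lerDl.
    by rewrite divfK ?gt_eqF//; lra.
  have H1 := d1P _ svd1; have H2 := d2P _ sd2.
  have H3 : `|phi (t + s) - phi t - s * q| <= (e1 / 2) * s.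
    rewrite /phi /q -dotZr -!dotBr scalerDl addrA scalemxAl.
    apply: le_trans (normr_dot_le _ _) _.
    apply: le_trans (ler_wpM2l _ H1) _; first by rewrite mulr_ge0.
    rewrite normrZ (gtr0_norm s0).
    have -> : e1 / 2 = B * (e1 / (B + B)).
      by rewrite [RHS]mulrC (_ : B + B = 2 * B) ?invfM ?mulrA ?divfK ?gt_eqF//; ring.
    rewrite (_ : _ * (_ * _) = (n%:R * `|w| * `|v|) * (e1 / (B + B)) * s); last by ring.
    apply: ler_wpM2r; first exact: ltW.
    by apply: ler_wpM2r; [exact: ltW|rewrite lerDl].
  have := le_trans (ler_normB _ _) (lerD H2 H3).
  rewrite (_ : _ - _ - _ = s * (q - d)); last by ring.
  by rewrite normrM !(gtr0_norm s0) -mulrDl -splitr mulrC ler_pM2r.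
rewrite subr0 mulr1 /phi scale1r scale0r addr0 -dotBr => cphi.
apply: le_trans cphi _; rewrite -lerBlDl -dotBr.
rewrite (_ : _ - _ - _ = (f (x' + v) - f (x + v)) - (f x' - f x)); last first.
  by apply/rowP => i; rewrite !mxE; ring.
apply: le_trans (ler_norm _) _; apply: le_trans (normr_dot_le _ _) _.
apply: (@le_trans _ _ (n%:R * `|w| * ((L + L) * (e / K)))).
  rewrite ler_wpM2l ?mulr_ge0//; apply: le_trans (ler_normB _ _) _.
  have Le : L * `|x' - x| <= L * (e / K) by rewrite ler_wpM2l// ltW.
  rewrite mulrDl lerD//; last exact: le_trans (lipf _ _) _.
  by apply: le_trans (lipf _ _) _; rewrite opprD addrACA subrr addr0.
have {2}-> : e = K * (e / K) by rewrite mulrC divfK// gt_eqF.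
rewrite mulrA; apply: ler_wpM2r; first exact/ltW/divr_gt0.
by rewrite /K lerDl.
Qed.

End mean_value.

(** * Convex hulls of compact sets of matrices *)

Section convex_combinations.
Context {R : realType} (V : normedModType R).
Implicit Types K C : set V.

(* By Caratheodory's theorem this is the convex hull of [K] as soon as [m] is at
   least the dimension; unlike the hull it is visibly compact. *)
Fixpoint iter_join K (m : nat) : set V :=
  if m is m'.+1 then
    [set t.1.1 *: t.1.2 + (1 - t.1.1) *: t.2 | t in (`[0, 1] `*` K) `*` iter_join K m']
  else K.

Definition combination K m (x : V) : Prop :=
  exists (c : 'I_m -> R) (X : 'I_m -> V),
    [/\ forall i, 0 <= c i, \sum_i c i = 1, forall i, K (X i) & x = \sum_i c i *: X i].

Lemma compact_iter_join K m : compact K -> compact (iter_join K m).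
Proof.
move=> cK; elim: m => [//|m IH] /=.
apply: continuous_compact; last first.
  apply: compact_setX => //; apply: compact_setX => //; exact: segment_compact.
apply: continuous_subspaceT => t.
have c11 : (fun u : R * V * V => u.1.1) @ t --> t.1.1.
  by apply: (@cvg_comp _ _ _ fst fst _ (nbhs t.1)); [exact: cvg_fst|exact: cvg_fst].
have c12 : (fun u : R * V * V => u.1.2) @ t --> t.1.2.
  by apply: (@cvg_comp _ _ _ fst snd _ (nbhs t.1)); [exact: cvg_fst|exact: cvg_snd].
apply: cvgD; first exact: cvgZ.
apply: cvgZ; last exact: cvg_snd.
by apply: cvgB => //; exact: cvg_cst.
Qed.

Lemma iter_joinS K m : iter_join K m `<=` iter_join K m.+1.
Proof.
move=> y Jy.
have [x Kx] : K !=set0 by elim: m y Jy => [|m IH] y; [exists y|move=> [[[s x] z]] [[_ /= Kx] _] _; exists x].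
exists ((0, x), y) => /=; last by rewrite scale0r add0r subr0 scale1r.
by split => //; split => //=; rewrite in_itv/= lexx ler01.
Qed.

Lemma iter_join_le K m k : (m <= k)%N -> iter_join K m `<=` iter_join K k.
Proof.
move=> mk; rewrite -(subnK mk); elim: (k - m)%N => [//|j IH].
by rewrite addSn; apply: subset_trans IH _; exact: iter_joinS.
Qed.

Lemma iter_join_sub K C m : convex_set C -> K `<=` C -> iter_join K m `<=` C.
Proof.
move=> cC KC; elim: m => [//|m IH] _ [[[s x] y] /= [[/= s01 Kx] Jy] <-].
have : @conv R (convex_lmodType V) (Itv01 (andP s01).1 (andP s01).2) x y \in C.
  by apply: cC; apply/mem_set; [exact: KC|exact: IH].
by move=> /set_mem.
Qed.

Lemma iter_join_combination K m x : iter_join K m x -> combination K m.+1 x.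
Proof.
elim: m x => [|m IH] x.
  by move=> Kx; exists (fun=> 1), (fun=> x); split => //; rewrite ?big_ord1 ?scale1r.
move=> [[[s y] z] /= [[/= s01 Ky] /IH[c [X [c0 c1 KX ->]]] <-]].
move: s01; rewrite in_itv/= => /andP[s0 s1].
exists (fun i => if unlift ord0 i is Some j then (1 - s) * c j else s),
  (fun i => if unlift ord0 i is Some j then X j else y); split.
- by move=> i; case: unliftP => [j _|_] //; rewrite mulr_ge0// subr_ge0.
- rewrite big_ord_recl unlift_none; under eq_bigr do rewrite liftK.
  by rewrite -mulr_sumr c1 mulr1 addrC subrK.
- by move=> i; case: unliftP.
rewrite [in RHS]big_ord_recl unlift_none; under [in RHS]eq_bigr do rewrite liftK -scalerA.
by rewrite -scaler_sumr.
Qed.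

Lemma combination_iter_join K m x : combination K m.+1 x -> iter_join K m x.
Proof.
elim: m x => [|m IH] x [c [X [c0 c1 KX ->]]].
  by rewrite big_ord1 in c1; rewrite big_ord1 c1 scale1r; exact: KX.
rewrite big_ord_recl in c1; rewrite big_ord_recl.
set s := \sum_(i < m.+1) c (lift ord0 i) in c1.
have s0 : 0 <= s by exact: sumr_ge0.
(* A vanishing remaining weight cannot be normalised; the combination is then its first point. *)
have [sE|sN0] := eqVneq s 0.
  have c00 : c ord0 = 1 by rewrite -c1 sE addr0.
  have -> : c ord0 *: X ord0 + \sum_(i < m.+1) c (lift ord0 i) *: X (lift ord0 i) = X ord0.
    rewrite c00 scale1r big1 ?addr0// => i _.
    have := sE; rewrite /s => /eqP; rewrite psumr_eq0// => /allP /(_ i (mem_index_enum _)) /eqP ->.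
    by rewrite scale0r.
  by apply: (@iter_join_le _ 0) => //; exact: KX.
exists ((c ord0, X ord0), s^-1 *: \sum_(i < m.+1) c (lift ord0 i) *: X (lift ord0 i)) => /=.
  split => /=; last first.
    apply: IH; exists (fun i => s^-1 * c (lift ord0 i)), (fun i => X (lift ord0 i)); split => //.
    - by move=> i; rewrite mulr_ge0// invr_ge0.
    - by rewrite -mulr_sumr mulVf.
    - by rewrite scaler_sumr; apply: eq_bigr => i _; rewrite scalerA.
  by split => //=; rewrite in_itv/= c0 -c1 lerDl.
have -> : 1 - c ord0 = s by rewrite -c1 addrAC subrr add0r.
by rewrite scalerA divff// scale1r.
Qed.

Lemma combination_conv K m1 m2 x y (l : R) : 0 <= l <= 1 ->
  combination K m1 x -> combination K m2 y ->
  combination K (m1 + m2) (l *: x + (1 - l) *: y).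
Proof.
move=> /andP[l0 l1] [c [X [c0 c1 KX ->]]] [d [Y [d0 d1 KY ->]]].
exists (fun i => match fintype.split i with inl a => l * c a | inr b => (1 - l) * d b end),
  (fun i => match fintype.split i with inl a => X a | inr b => Y b end).
have sl a : fintype.split (lshift m2 a) = inl a by rewrite -[lshift _ _]/(unsplit (inl a)) unsplitK.
have sr b : fintype.split (rshift m1 b) = inr b by rewrite -[rshift _ _]/(unsplit (inr b)) unsplitK.
split.
- by move=> i; case: fintype.split => ?; rewrite mulr_ge0// subr_ge0.
- rewrite big_split_ord /=; under eq_bigr do rewrite sl; under [X in _ + X]eq_bigr do rewrite sr.
  by rewrite -!mulr_sumr c1 d1 !mulr1 addrC subrK.
- by move=> i; case: fintype.split.
rewrite big_split_ord /=; under [in RHS]eq_bigr do rewrite sl -scalerA.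
under [X in _ = _ + X]eq_bigr do rewrite sr -scalerA.
by rewrite -!scaler_sumr.
Qed.

End convex_combinations.

Section caratheodory.
Context {R : realType} (p q : nat).
Implicit Type K : set 'M[R]_(p, q).

(** The rows [(X i, 1)] live in dimension [p * q + 1], so more of them than that are linearly
    dependent. The column of ones makes the coefficients sum to [0], so some coefficient is
    positive. *)
Lemma affine_dependence m (X : 'I_m -> 'M[R]_(p, q)) : ((p * q).+1 < m)%N ->
  exists2 a : 'I_m -> R, exists i, 0 < a i &
    \sum_i a i = 0 /\ \sum_i a i *: X i = 0.
Proof.
move=> dm.
pose Y := row_mx (\matrix_(i < m) mxvec (X i)) (const_mx 1 : 'cV[R]_m).
have : kermx Y != 0.
  rewrite kermx_eq0 -row_leq_rank -ltnNge (leq_ltn_trans (rank_leq_col _))//.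
  by rewrite addn1.
move=> /rowV0Pn[u /sub_kermxP uY u0].
have : u *m Y = 0 by []; rewrite /Y mul_mx_row -[X in _ = X -> _]row_mx0 => /eq_row_mx[uX u1].
have sum0 : \sum_i u ord0 i = 0.
  move/matrixP/(_ ord0 ord0) : u1; rewrite !mxE => E; rewrite -[RHS]E.
  by apply: eq_bigr => i _; rewrite mxE mulr1.
have sumX : \sum_i u ord0 i *: X i = 0.
  apply: (can_inj mxvecK); rewrite linear_sum linear0 -[RHS]uX mulmx_sum_row.
  by apply: eq_bigr => i _; rewrite linearZ/= rowK.
exists (fun i => u ord0 i) => //.
apply: contrapT => /forallNP un.
have un' i : u ord0 i <= 0 by rewrite leNgt; apply/negP/un.
move/eqP: u0; apply; apply/rowP => i; rewrite mxE; apply/eqP.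
move: sum0 => /eqP; rewrite -oppr_eq0 -sumrN psumr_eq0 => [/allP /(_ i (mem_index_enum _))|j _].
  by rewrite oppr_eq0.
by rewrite oppr_ge0.
Qed.

(** Moving the coefficients along an affine dependence changes neither the point nor the total
    weight. The motion stops when the first coefficient, at the index minimising [c i / a i] over
    [a i > 0], reaches [0]. *)
Lemma combination_reduce K m x : ((p * q).+1 < m.+1)%N ->
  combination K m.+1 x -> combination K m x.
Proof.
move=> dm [c [X [c0 c1 KX ->]]].
have [a [i1 ai1] [sa saX]] := affine_dependence X dm.
case: (@arg_minP _ _ _ i1 (fun i => 0 < a i) (fun i => c i / a i) ai1) => i0 ai0 i0min.
pose th := c i0 / a i0.
have th0 : 0 <= th by rewrite divr_ge0// ltW.
pose c' i := c i - th * a i.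
have c'0 i : 0 <= c' i.
  rewrite subr_ge0; have [ai|ai] := ltP 0 (a i).
    by rewrite -ler_pdivlMr//; exact: i0min.
  by apply: le_trans (c0 i); rewrite mulr_ge0_le0.
have c'i0 : c' i0 = 0 by rewrite /c' /th divfK ?subrr// gt_eqF.
exists (fun i => c' (lift i0 i)), (fun i => X (lift i0 i)); split => //.
- have : \sum_i c' i = c' i0 + \sum_i c' (lift i0 i) by exact: (bigD1_ord i0).
  by rewrite c'i0 add0r => <-; rewrite sumrB c1 -mulr_sumr sa mulr0 subr0.
have : \sum_i c' i *: X i = c' i0 *: X i0 + \sum_i c' (lift i0 i) *: X (lift i0 i).
  exact: (bigD1_ord i0).
rewrite c'i0 scale0r add0r => <-.
under [RHS]eq_bigr do rewrite scalerBl -scalerA.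
by rewrite sumrB -scaler_sumr saX scaler0 subr0.
Qed.

(** [iter_join K (p * q)] combines [p * q + 1] points, the Caratheodory number in dimension
    [p * q]. *)
Lemma combination_caratheodory K m x : combination K m x -> iter_join K (p * q) x.
Proof.
move=> Kx; have [m' m'd Kx'] : exists2 m', (m' <= (p * q).+1)%N & combination K m' x.
  elim: m Kx => [|m IH] Kx; first by exists 0%N.
  have [md|md] := leqP m.+1 (p * q).+1; first by exists m.+1.
  by apply: IH; exact: combination_reduce md Kx.
case: m' m'd Kx' => [_ [c [X [_]]]|m' m'd /combination_iter_join]; last exact: iter_join_le.
by rewrite big_ord0 => /esym/eqP; rewrite oner_eq0.
Qed.

Lemma iter_join_convex K x y (l : R) : 0 <= l <= 1 ->
  iter_join K (p * q) x -> iter_join K (p * q) y ->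
  iter_join K (p * q) (l *: x + (1 - l) *: y).
Proof.
move=> l01 /iter_join_combination Kx /iter_join_combination Ky.
exact: combination_caratheodory (combination_conv l01 Kx Ky).
Qed.

Lemma iter_join_hull K : iter_join K (p * q) `<=` convex_hull K.
Proof. by move=> x Jx C [cC KC]; exact: (iter_join_sub cC KC Jx). Qed.

End caratheodory.

Lemma continuous_sum (R : realType) (T : topologicalType) (I : finType) (F : I -> T -> R) :
  (forall i, continuous (F i)) -> continuous (fun x => \sum_i F i x).
Proof.
by move=> cF x; apply: cvg_big => [|i _]; [exact: add_continuous|exact: cF].
Qed.

Lemma continuous_prod (R : realType) (T : topologicalType) (I : finType) (F : I -> T -> R) :
  (forall i, continuous (F i)) -> continuous (fun x => \prod_i F i x).
Proof.
by move=> cF x; apply: cvg_big => [|i _]; [exact: mul_continuous|exact: cF].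
Qed.

(** * Separation of a compact convex set from the origin *)

Section separation.
Context {R : realType} (n : nat).

Lemma continuous_dotxx : continuous (fun y : 'rV[R]_n => dot y y).
Proof.
apply: continuous_sum => i y.
by apply: (@continuousM _ _ (fun x : 'rV[R]_n => x ord0 i) (fun x => x ord0 i)); exact: coord_continuous.
Qed.

(* The point [p] of minimal Euclidean norm of [C] satisfies <p, y> >= <p, p> on [C]. *)
Lemma compact_convex_separation (C : set 'rV[R]_n) (c : R) : compact C ->
  (forall x y (l : R), 0 <= l <= 1 -> C x -> C y -> C (l *: x + (1 - l) *: y)) ->
  0 < c -> (forall y, C y -> c <= `|y|) ->
  exists2 w : 'rV[R]_n, `|w| <= 1 & forall y, C y -> c <= dot w y.
Proof.
move=> cC convC c0 Cc.
have [C0|C0] := pselect (C !=set0); last first.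
  by exists 0 => [|y Cy]; [rewrite normr0|exfalso; apply: C0; exists y].
have [p /set_mem Cp pmin] := EVT_min_rV C0 cC (continuous_subspaceT continuous_dotxx).
have p0 : 0 < `|p| by exact: lt_le_trans (Cc _ Cp).
exists (`|p|^-1 *: p) => [|y Cy].
  by rewrite normrZ normfV normr_id mulVf// gt_eqF.
rewrite dotZl ler_pdivlMl//.
suff ppy : dot p p <= dot p y.
  apply: le_trans ppy; apply: le_trans (sqr_norm_le_dot _).
  by rewrite expr2 ler_wpM2l// Cc.
apply/ler_addgt0Pr => e e0.
pose D := dot (y - p) (y - p).
have D0 : 0 <= D by apply: sumr_ge0 => i _; rewrite -expr2 sqr_ge0.
(* Moving from [p] towards [y] by the fraction [l] changes the squared length by
   [l * (2 * (dot p y - dot p p) + l * D)]; this [l] keeps the second-order term [l * D] below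
   [e]. *)
pose l : R := Num.min 1 (e / (D + 1)).
have D1 : 0 < D + 1 by rewrite ltr_wpDl.
have l0 : 0 < l by rewrite lt_min ltr01 divr_gt0.
have l1 : l <= 1 by rewrite ge_min lexx.
have lD : l * D <= e.
  apply: (@le_trans _ _ (e / (D + 1) * (D + 1))); last by rewrite divfK// gt_eqF.
  apply: ler_pM => //; [exact: ltW|by rewrite ge_min lexx orbT|by rewrite lerDl].
have l01 : 0 <= l <= 1 by rewrite l1 ltW.
have := pmin (l *: y + (1 - l) *: p); rewrite mem_set; last exact: convC.
move=> /(_ isT).
have -> : l *: y + (1 - l) *: p = p + l *: (y - p) by apply/rowP => i; rewrite !mxE; ring.
rewrite dotDl !dotDr !dotZl !dotZr -/D (dotC _ p) -addrA lerDl dotBr.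
move: (dot p y) (dot p p) => a b H.
have : 0 <= l * (2 * (a - b) + l * D) by move: H; congr (0 <= _); ring.
by rewrite pmulr_rge0//; lra.
Qed.

End separation.

(** * Limiting Jacobians *)

Section determinant_bounds.
Context {R : realType}.

Lemma continuous_det n : continuous (fun B : 'M[R]_n => \det B).
Proof.
apply: continuous_sum => s B.
apply: (@continuousM _ _ (cst ((-1) ^+ s)) (fun B : 'M[R]_n => \prod_i B i (s i))); first exact: cst_continuous.
by apply: continuous_prod => i {}B; exact: coord_continuous.
Qed.

Lemma normr_det_le n (B : 'M[R]_n) (M : R) : (forall i j, `|B i j| <= M) ->
  `|\det B| <= n`!%:R * M ^+ n.
Proof.
move=> BM; apply: le_trans (ler_norm_sum _ _ _) _.
have -> : n`!%:R * M ^+ n = \sum_(s : {perm 'I_n}) M ^+ n by rewrite sumr_const card_Sn mulr_natl.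
apply: ler_sum => s _; rewrite normrM normr_sign mul1r normr_prod.
apply: (@le_trans _ _ (\prod_(i < n) M)); last by rewrite prodr_const card_ord.
by apply: ler_prod => i _; rewrite normr_ge0 BM.
Qed.

(** From [v *m B *m \adj B = \det B *: v], with the cofactors bounded by [(n-1)! * |M|^(n-1)]. The
    constant depends only on [n], [M] and [d], which is the source of the uniformity over all
    points. *)
Lemma coercive_of_det n (M d : R) : 0 < d ->
  exists2 c : R, 0 < c & forall B : 'M[R]_n, `|B| <= M -> d <= `|\det B| ->
    forall v : 'rV[R]_n, c * `|v| <= `|v *m B|.
Proof.
move=> d0; pose Q := n.-1`!%:R * `|M| ^+ n.-1.
have Q0 : 0 <= Q by rewrite mulr_ge0.
have nQ : 0 < n%:R * Q + 1 by rewrite ltr_wpDl// mulr_ge0.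
exists (d / (n%:R * Q + 1)) => [|B BM dB v]; first by rewrite divr_gt0.
have adjQ : `|\adj B| <= Q.
  apply: norm_le_entries => // i j; rewrite mxE /cofactor normrM normrX normrN1 expr1n mul1r.
  apply: normr_det_le => a b; rewrite !mxE.
  by apply: le_trans (entry_le_norm _ _ _) _; apply: le_trans BM (ler_norm _).
rewrite mulrAC ler_pdivrMr//.
have : `|v *m B *m \adj B| <= n%:R * `|v *m B| * `|\adj B| by exact: norm_mulmx_le.
rewrite -mulmxA mul_mx_adj mul_mx_scalar normrZ => H.
apply: le_trans (ler_wpM2r (normr_ge0 _) dB) _; apply: le_trans H _.
rewrite mulrAC mulrC; apply: ler_wpM2l => //.
by apply: le_trans (ler_wpM2l _ adjQ) _; rewrite ?lerDl.
Qed.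

Lemma horner_char_poly (F : comNzRingType) n (A : 'M[F]_n) (a : F) :
  (char_poly A).[a] = \det (a%:M - A).
Proof.
rewrite /char_poly -horner_evalE -det_map_mx; congr (\det _).
by apply/matrixP => i j; rewrite !mxE /= horner_evalE !hornerE hornerMn hornerX.
Qed.

Local Open Scope complex_scope.

Lemma normr_det_ge_spectrum n (A : 'M[R]_n) (t r : R) : 0 <= r ->
  (forall z : R[i], eigenvalue (map_mx (real_complex R) A) z -> r%:C <= `|z - t%:C|) ->
  r ^+ n <= `|\det (A - t%:M)|.
Proof.
move=> r0 spec.
pose Ac := map_mx (real_complex R) A.
have [rs prs] := closed_field_poly_normal (char_poly Ac).
rewrite (monicP (char_poly_monic _)) scale1r in prs.
have szrs : size rs = n.
  by apply/eqP; rewrite -eqSS -(size_char_poly Ac) prs size_prod_XsubC.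
have dE : \det ((t%:C)%:M - Ac) = (\det (t%:M - A))%:C.
  rewrite -[RHS]/(real_complex R _) -det_map_mx; congr (\det _).
  by apply/matrixP => i j; rewrite !mxE rmorphB rmorphMn.
have : (r ^+ n)%:C <= `|\det ((t%:C)%:M - Ac)|.
  rewrite -horner_char_poly prs horner_prod normr_prod rmorphXn /= -szrs.
  have : forall z, z \in rs -> r%:C <= `|('X - z%:P).[t%:C]|.
    move=> z zrs; rewrite hornerXsubC distrC; apply: spec.
    by rewrite eigenvalue_root_char -/Ac prs root_prod_XsubC.
  have r0' : 0 <= r%:C by rewrite lecR.
  elim: rs {prs szrs} => [|z rs IH] rsP; first by rewrite big_nil.
  rewrite big_cons exprS; apply: ler_pM => //.
  - by rewrite exprn_ge0.
  - by apply: rsP; rewrite mem_head.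
  - by apply: IH => y yrs; apply: rsP; rewrite inE yrs orbT.
rewrite dE normc_def /= expr0n addr0 sqrtr_sqr lecR => H.
by apply: le_trans H _; rewrite -opprB -scaleN1r detZ normrM normrX normrN1 expr1n mul1r.
Qed.

End determinant_bounds.

Section limiting_jacobians.
Context {R : realType} (n : nat).
Variables (f : 'rV[R]_n -> 'rV[R]_n) (K : R).
Hypotheses (K0 : 0 <= K) (lipf : forall x y, `|f x - f y| <= K * `|x - y|).

Lemma norm_mxvec p q (A : 'M[R]_(p, q)) : `|mxvec A| = `|A|.
Proof.
apply/eqP; rewrite eq_le; apply/andP; split; apply: norm_le_entries => // i j.
  by rewrite ord1; case/mxvec_indexP: j => a b; rewrite mxvecE entry_le_norm.
by rewrite -(mxvecE A) entry_le_norm.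
Qed.

Lemma norm_jacobian_le (z : 'rV[R]_n) : differentiable f z -> `|'J f z| <= K.
Proof.
move=> df; apply: norm_le_entries => // i j; apply/ler_addgt0Pr => e e0.
have [d d0 dP] := jacobian_bound df e0.
pose h : 'rV[R]_n := (d / 2) *: delta_mx ord0 i.
have d2 : 0 < d / 2 by rewrite divr_gt0.
have hE : `|h| = d / 2 by rewrite normrZ norm_delta_mx mulr1 gtr0_norm.
have := dP h; rewrite hE => /(_ _) H.
have {}H := H (_ : d / 2 < d).
have {}H : `|f (z + h) - f z - h *m 'J f z| <= e * (d / 2) by apply: H; lra.
have H2 := lipf (z + h) z; rewrite addrAC subrr add0r hE in H2.
have : `|h *m 'J f z| <= K * (d / 2) + e * (d / 2).
  rewrite -[X in `|X|](subKr (f (z + h) - f z)).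
  by apply: le_trans (ler_normB _ _) (lerD _ _).
have hJ : (h *m 'J f z) ord0 j = d / 2 * 'J f z i j.
  by rewrite -scalemxAl mxE -rowE mxE.
move=> /(le_trans (entry_le_norm _ ord0 j)); rewrite hJ normrM gtr0_norm//.
by rewrite -mulrDl mulrC ler_pM2r.
Qed.

(** A form without sequences, in which diagonal arguments become a choice of [e / 2]. *)
Lemma limiting_jacobiansP (x : 'rV[R]_n) A : limiting_jacobians f x A <->
  forall e : R, 0 < e -> exists z : 'rV[R]_n, [/\ `|z - x| < e, differentiable f z & `|'J f z - A| < e].
Proof.
split=> [[u [ux df uA]] e e0|H].
  have : \forall i \near \oo, `|u i - x| < e /\ `|'J f (u i) - A| < e.
    by near=> i; split; near: i; [exact: cvgr_distC_lt ux _ e0|exact: cvgr_distC_lt uA _ e0].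
  by move=> [N _ /(_ N (leqnn N))[? ?]]; exists (u N).
have /choice[u uP] : forall i : nat, exists z : 'rV[R]_n,
      [/\ `|z - x| < i.+1%:R^-1, differentiable f z & `|'J f z - A| < i.+1%:R^-1].
  by move=> i; apply: H; rewrite invr_gt0.
have small (V : normedModType R) (v : nat -> V) (l : V) :
    (forall i, `|v i - l| < i.+1%:R^-1) -> v @ \oo --> l.
  move=> vl; apply/cvgrPdist_lt => e e0; near=> i.
  rewrite distrC; apply: lt_trans (vl i) _.
  near: i; exact: near_infty_natSinv_lt (PosNum e0).
exists u; split => [|i|]; [|by have [] := uP i|].
- by apply: small => i; have [] := uP i.
- by apply: small => i; have [] := uP i.
Unshelve. all: by end_near. Qed.

Lemma norm_limiting_jacobian_le x A : limiting_jacobians f x A -> `|A| <= K.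
Proof.
move=> /limiting_jacobiansP LA; apply/ler_addgt0Pr => e e0.
have [z [_ dz zA]] := LA e e0.
rewrite -[A](subKr ('J f z)); apply: le_trans (ler_normB _ _) _.
by apply: lerD (ltW zA); exact: norm_jacobian_le.
Qed.

Lemma compact_limiting_jacobians x : compact (limiting_jacobians f x).
Proof.
(* Heine-Borel is applied to row vectors, through the isometry [mxvec]. *)
have -> : limiting_jacobians f x = vec_mx @` (mxvec @` limiting_jacobians f x).
  rewrite image_comp; apply/seteqP; split => [A LA|_ [A LA <-]] /=.
    by exists A => //=; rewrite mxvecK.
  by rewrite mxvecK.
apply: continuous_compact.
  apply: continuous_subspaceT; apply: (@lipschitz_bound_continuous _ _ _ _ 1) => u v.
  by rewrite mul1r -linearB/= -norm_mxvec vec_mxK.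
apply: bounded_closed_compact.
  exists K; split; first exact: num_real.
  by move=> M KM _ [A LA <-] /=; rewrite norm_mxvec (le_trans (norm_limiting_jacobian_le LA))// ltW.
move=> v clv; exists (vec_mx v); last by rewrite vec_mxK.
apply/limiting_jacobiansP => e e0.
have e2 : 0 < e / 2 by rewrite divr_gt0.
have [_ [[A LA <-]]] := clv _ (nbhsx_ballx v (e / 2) e2).
rewrite -ball_normE /= => vA.
have [z [zx dz zA]] := (limiting_jacobiansP _ _).1 LA _ e2.
exists z; split => //; first by lra.
rewrite -(subrK A ('J f z)) -addrA [e]splitr.
apply: le_lt_trans (ler_normD _ _) (ltrD zA _).
by rewrite -norm_mxvec linearB/= vec_mxK distrC.
Qed.

(** Upper semicontinuity of the limiting Jacobians. Otherwise Jacobians at points tending to [x]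
    would stay [e] away from all of them; being bounded by [K], they have a cluster point, which is
    itself a limiting Jacobian at [x]. *)
Lemma jacobian_near_limiting (x : 'rV[R]_n) (e : R) : 0 < e ->
  exists2 r : R, 0 < r & forall z : 'rV[R]_n, `|z - x| < r -> differentiable f z ->
    exists2 A, limiting_jacobians f x A & `|'J f z - A| < e.
Proof.
move=> e0; apply: contrapT => /forall2NP noR.
have /choice[u uP] : forall i : nat, exists z : 'rV[R]_n, [/\ `|z - x| < i.+1%:R^-1, differentiable f z &
    forall A, limiting_jacobians f x A -> ~ `|'J f z - A| < e].
  move=> i; have [|/existsNP[z /not_implyP[zx /not_implyP[dz nA]]]] := noR i.+1%:R^-1.
    by rewrite invr_gt0 ltr0n.
  by exists z; split => // A LA Ae; apply: nA; exists A.
pose v i := mxvec ('J f (u i)).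
have cB : compact [set w : 'rV[R]_(n * n) | `|w| <= K].
  apply: bounded_closed_compact.
    exists K; split; first exact: num_real.
    by move=> M KM w /= /le_trans; apply; exact: ltW.
  apply: (@closed_comp _ _ (fun w : 'rV[R]_(n * n) => `|w|) [set y | y <= K]); last exact: closed_le.
  by move=> w _; exact: norm_continuous.
have [|w [_ clw]] := cB (v @ \oo) _.
  by exists 0%N => // i _ /=; rewrite /v norm_mxvec; apply: norm_jacobian_le; have [] := uP i.
have near_w d (N : nat) : 0 < d -> exists2 i, (N <= i)%N & `|'J f (u i) - vec_mx w| < d.
  move=> d0; have := clw [set v i | i in [set i | (N <= i)%N]] (ball w d).
  case.
  - by exists N => // i Ni; exists i.
  - exact: nbhsx_ballx.
  move=> _ [[i Ni <-]]; rewrite -ball_normE /= => vw; exists i => //.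
  by rewrite -norm_mxvec linearB/= vec_mxK distrC.
have Lw : limiting_jacobians f x (vec_mx w).
  apply/limiting_jacobiansP => d d0.
  have [N] := ltr_add_invr d0; rewrite add0r => Nd.
  have [i Ni iw] := near_w d N d0.
  have [ux du _] := uP i; exists (u i); split => //.
  apply: lt_trans ux _; apply: le_lt_trans Nd.
  by rewrite lef_pV2 ?posrE ?ltr0n// ler_nat.
have [i _ iw] := near_w e 0%N e0.
by have [_ _ /(_ _ Lw)] := uP i.
Qed.

End limiting_jacobians.

(** * Local expansivity and solvability *)

Lemma norm_trmx (R : realType) m n (A : 'M[R]_(m, n)) : `|A^T| = `|A|.
Proof.
apply/eqP; rewrite eq_le; apply/andP; split; apply: norm_le_entries => // i j.
  by rewrite mxE entry_le_norm.
by have := entry_le_norm A^T j i; rewrite mxE.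
Qed.

Lemma dot_mulmx_tr (R : realType) n (A : 'M[R]_n) (v w : 'rV[R]_n) :
  dot v (w *m A^T) = dot w (v *m A).
Proof.
rewrite /dot; under eq_bigr do rewrite mxE big_distrr/=.
rewrite exchange_big/=; apply: eq_bigr => i _; rewrite mxE big_distrr/=.
by apply: eq_bigr => j _; rewrite mxE; ring.
Qed.

Section local_regularity.
Context {R : realType} (n : nat).
Implicit Types g : 'rV[R]_n -> 'rV[R]_n.

Definition expansive_near g (x0 : 'rV[R]_n) (r c : R) :=
  forall x y : 'rV[R]_n, `|x - x0| < r -> `|y - x0| < r -> c * `|x - y| <= `|g x - g y|.

(* For [w = y - g z] the direction [v] decreases the distance from [g z] to [y];
   it does not depend on [z]. *)
Definition ascent_near g (x0 : 'rV[R]_n) (r c : R) :=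
  forall w : 'rV[R]_n, exists2 v : 'rV[R]_n, `|v| <= 1 &
    forall (z : 'rV[R]_n) (s : R), 0 <= s -> `|z - x0| < r -> `|z + s *: v - x0| < r ->
      c * s * `|w| <= dot w (g (z + s *: v) - g z).

Definition regular_near g x0 r c := expansive_near g x0 r c /\ ascent_near g x0 r c.

Lemma regular_near_sub g (x0 x1 : 'rV[R]_n) (r0 r1 c0 c1 : R) :
  `|x1 - x0| + r1 <= r0 -> c1 <= c0 ->
  regular_near g x0 r0 c0 -> regular_near g x1 r1 c1.
Proof.
move=> r10 c10 [E A].
have sub (x : 'rV[R]_n) : `|x - x1| < r1 -> `|x - x0| < r0.
  move=> xx1; rewrite -(subrKA x1); apply: le_lt_trans (ler_normD _ _) _; lra.
split=> [x y /sub x0r /sub y0r|w].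
  by apply: le_trans (E _ _ x0r y0r); rewrite ler_wpM2r.
have [v v1 vP] := A w; exists v => // z s s0 /sub zr /sub zsr.
by apply: le_trans (vP _ _ s0 zr zsr); rewrite ler_wpM2r// ler_wpM2r.
Qed.

(** The radius is unchanged and the constant is halved, for all small [t] at once; this lets the
    solvability of [f_k] near a point be deduced from the regularity of [f] there, fixed before
    [k]. *)
Lemma regular_near_shift g (x0 : 'rV[R]_n) (r c t : R) : `|t| * n.+1%:R <= c / 2 ->
  regular_near g x0 r c -> regular_near (fun x => g x - t *: x) x0 r (c / 2).
Proof.
move=> tc [E A].
have tc1 : `|t| <= c / 2 by apply: le_trans tc; rewrite ler_peMr// ler1n.
split=> [x y xr yr|w].
  have := E _ _ xr yr.
  have -> : g x - t *: x - (g y - t *: y) = g x - g y - t *: (x - y).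
    by apply/rowP => i; rewrite !mxE; ring.
  have := lerB_dist (g x - g y) (t *: (x - y)); rewrite normrZ.
  have := ler_wpM2r (normr_ge0 (x - y)) tc1.
  by move: `|t| `|x - y| `|_ - _| `|_ - _| => *; lra.
have [v v1 vP] := A w; exists v => // z s s0 zr zsr.
have := vP z s s0 zr zsr.
have -> : g (z + s *: v) - t *: (z + s *: v) - (g z - t *: z) =
    g (z + s *: v) - g z - t *: (s *: v) by apply/rowP => i; rewrite !mxE; ring.
rewrite [dot w (_ - t *: _)]dotBr !dotZr.
suff : t * (s * dot w v) <= c / 2 * s * `|w|.
  by move: (dot _ _) (t * _) => a b; rewrite -!mulrA => ? ?; lra.
apply: le_trans (ler_norm _) _; rewrite !normrM (ger0_norm s0).
have dwv : `|dot w v| <= n.+1%:R * `|w|.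
  apply: le_trans (normr_dot_le _ _) _.
  apply: (@le_trans _ _ (n%:R * `|w|)); first by rewrite ler_piMr// mulr_ge0.
  by rewrite ler_wpM2r// ler_nat.
apply: (@le_trans _ _ (`|t| * (s * (n.+1%:R * `|w|)))).
  by rewrite ler_wpM2l// ler_wpM2l.
rewrite [leLHS](_ : _ = `|t| * n.+1%:R * (s * `|w|)); last by ring.
by rewrite -[leRHS]mulrA ler_wpM2r// mulr_ge0.
Qed.

Lemma compact_norm_ball (x : 'rV[R]_n) (rho : R) : compact [set z : 'rV[R]_n | `|z - x| <= rho].
Proof.
apply: bounded_closed_compact.
  exists (`|x| + rho); split; first exact: num_real.
  move=> M xM z /= zB; rewrite -(subrK x z); apply: le_trans (ler_normD _ _) _.
  by move: `|_| `|_| zB xM => *; lra.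
apply: (@closed_comp _ _ (fun w : 'rV[R]_n => `|w - x|) [set u | u <= rho]); last exact: closed_le.
move=> w _; apply: (@lipschitz_bound_continuous _ _ _ _ 1) => u v; rewrite mul1r.
by apply: le_trans (ler_dist_dist _ _) _; rewrite opprB addrA subrK.
Qed.

Lemma local_solvability g (K c r rho : R) (x0 x y : 'rV[R]_n) : 0 <= K ->
  (forall u v, `|g u - g v| <= K * `|u - v|) -> 0 < c ->
  regular_near g x0 r c -> 0 < rho -> `|x - x0| + rho < r ->
  n.+2%:R * `|y - g x| < c * rho ->
  exists2 x' : 'rV[R]_n, `|x' - x| < rho & g x' = y.
Proof.
move=> K0 lipg c0 [E A] rho0 xr yx.
pose phi z := dot (y - g z) (y - g z).
pose B := [set z : 'rV[R]_n | `|z - x| <= rho].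
have cg : continuous g by exact: lipschitz_bound_continuous lipg.
have cB : compact B by exact: compact_norm_ball.
have cphi : continuous phi.
  move=> z; apply: (@continuous_comp _ _ _ (fun z : 'rV[R]_n => y - g z) (fun w => dot w w)).
    apply: (@lipschitz_bound_continuous _ _ _ _ K) => u v.
    by rewrite opprB addrC subrKA distrC.
  exact: continuous_dotxx.
have Bx : B x by rewrite /B /= subrr normr0 ltW.
have [|z /set_mem Bz zmin] := EVT_min_rV _ cB (continuous_subspaceT cphi); first by exists x.
have inB u : B u -> `|u - x0| < r.
  move=> Bu; rewrite -(subrKA x); apply: le_lt_trans (ler_normD _ _) _.
  by apply: le_lt_trans xr; rewrite addrC lerD2l.
have zx : `|z - x| < rho.
  (* [z] minimises the Euclidean distance; comparing norms through [n <= (n + 1)^2] gives the factor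
     [n.+1] and, with expansivity, [c * |z - x| <= n.+2%:R * |y - g x|]. Hence [z] is interior to
     the ball. *)
  have yz : `|y - g z| <= n.+1%:R * `|y - g x|.
    rewrite -(@ler_pXn2r _ 2)// ?nnegrE ?mulr_ge0//.
    apply: le_trans (sqr_norm_le_dot _) _.
    apply: le_trans (zmin x _) _; first exact: mem_set.
    apply: le_trans (ler_norm _) _; apply: le_trans (normr_dot_le _ _) _.
    rewrite -mulrA -expr2 exprMn ler_wpM2r// ?sqr_ge0//.
    by rewrite -natrX ler_nat; nia.
  have := E _ _ (inB _ Bz) (inB _ Bx).
  have : `|g z - g x| <= `|y - g x| + `|y - g z|.
    rewrite [g z - g x](_ : _ = y - g x - (y - g z)); first exact: ler_normB.
    by apply/rowP => i; rewrite !mxE; ring.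
  rewrite -(ltr_pM2l c0).
  move: yx yz; rewrite -(natr1 n.+1) mulrDl mul1r.
  by move: (n.+1%:R * `|y - g x|) (`|y - g x|) (`|y - g z|) (`|g z - g x|) => *; lra.
exists z => //; apply/eqP; rewrite eq_sym -subr_eq0 -normr_eq0; apply/negPn/negP => w0.
pose w := y - g z.
have {}w0 : 0 < `|w| by rewrite lt_neqAle eq_sym w0 /=.
have [v v1 vP] := A w.
pose Q := n%:R * K ^+ 2 + 1.
have Q0 : 0 < Q by rewrite ltr_wpDl// mulr_ge0// sqr_ge0.
(* The step stays in the ball, and is so short that [dot d d < Q * s * s <= c * s * |w| <= dot w d];
   hence [phi] drops strictly, against minimality. *)
pose s := Num.min (rho - `|z - x|) (c * `|w| / Q).
have s0 : 0 < s by rewrite lt_min subr_gt0 zx /= divr_gt0// mulr_gt0.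
have sv : `|s *: v| <= s by rewrite normrZ gtr0_norm// ler_piMr// ltW.
have Bzs : B (z + s *: v).
  rewrite /B /= addrAC; apply: le_trans (ler_normD _ _) _.
  have : s <= rho - `|z - x| by rewrite ge_min lexx.
  by move: (s) sv `|_| => *; lra.
have up := vP _ _ (ltW s0) (inB _ Bz) (inB _ Bzs).
pose d := g (z + s *: v) - g z; rewrite -/d in up.
have dd : dot d d < Q * s * s.
  apply: le_lt_trans (ler_norm _) _; apply: le_lt_trans (normr_dot_le _ _) _.
  have dn : `|d| <= K * s.
    by apply: le_trans (lipg _ _) _; rewrite addrAC subrr add0r ler_wpM2l.
  apply: (@le_lt_trans _ _ (n%:R * K ^+ 2 * (s * s))).
    rewrite (_ : n%:R * K ^+ 2 * (s * s) = n%:R * (K * s) * (K * s)); last by ring.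
    by rewrite -[leLHS]mulrA -[leRHS]mulrA; apply: ler_wpM2l => //; apply: ler_pM.
  by rewrite -[ltRHS]mulrA ltr_pM2r ?mulr_gt0// ltrDl.
have Qs : Q * s <= c * `|w|.
  by rewrite mulrC -ler_pdivlMr// ge_min lexx orbT.
have := zmin (z + s *: v) (mem_set Bzs); rewrite /phi.
have -> : y - g (z + s *: v) = w - d by rewrite /w /d; apply/rowP => i; rewrite !mxE; ring.
rewrite [leLHS](_ : _ = dot w w)//.
rewrite [leRHS](_ : _ = dot w w - dot w d - (dot w d - dot d d)); last first.
  by rewrite (dotBr (w - d) w d) (dotBl w d w) (dotBl w d d) (dotC d w).
have : Q * s * s <= c * s * `|w|.
  by rewrite (mulrAC c) ler_pM2r.
have : 0 < c * s * `|w| by rewrite !mulr_gt0.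
by move: dd up; move: (dot w w) (dot w d) (dot d d) (Q * s * s) (c * s * _) => *; lra.
Qed.

End local_regularity.

Section local_jacobians.
Context {R : realType} (n : nat).
Variables (f : 'rV[R]_n -> 'rV[R]_n) (K : R).
Hypotheses (K0 : 0 <= K) (lipf : forall x y, `|f x - f y| <= K * `|x - y|).

Let hull x := iter_join (limiting_jacobians f x) (n * n).

Lemma compact_convex_image_separation (C : set 'M[R]_n) (h : 'M[R]_n -> 'rV[R]_n) (L c : R) :
  compact C -> (forall A B (l : R), 0 <= l <= 1 -> C A -> C B -> C (l *: A + (1 - l) *: B)) ->
  (forall A B (l : R), h (l *: A + (1 - l) *: B) = l *: h A + (1 - l) *: h B) ->
  (forall A B, `|h A - h B| <= L * `|A - B|) ->
  0 < c -> (forall A, C A -> c <= `|h A|) ->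
  exists2 w : 'rV[R]_n, `|w| <= 1 & forall A, C A -> c <= dot w (h A).
Proof.
move=> cC convC affh liph c0 hc.
have [||||w w1 wP] := @compact_convex_separation R n (h @` C) c.
- exact: continuous_compact (continuous_subspaceT (lipschitz_bound_continuous liph)) cC.
- move=> _ _ l l01 [A CA <-] [B CB <-]; exists (l *: A + (1 - l) *: B); last exact: affh.
  exact: convC.
- exact: c0.
- by move=> _ [A CA <-]; exact: hc.
by exists w => // A CA; apply: wP; exists A.
Qed.

(** Replacing a Jacobian near [x0] by a limiting one costs [n%:R ^+ 2 * e * |v| * |w|], one factor
    [n] from the matrix product and one from [dot]. *)
Lemma slope_near (x0 v w : 'rV[R]_n) (r e t c : R) :
  (forall z : 'rV[R]_n, `|z - x0| < r -> differentiable f z ->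
     exists2 A, limiting_jacobians f x0 A & `|'J f z - A| < e) ->
  (forall A, limiting_jacobians f x0 A -> c <= dot w (v *m (A - t%:M))) ->
  forall x : 'rV[R]_n, `|x - x0| < r -> `|x + v - x0| < r ->
    c - n%:R ^+ 2 * e * `|v| * `|w| <= dot w (f (x + v) - t *: (x + v) - (f x - t *: x)).
Proof.
move=> near slope x xr xvr.
have -> : f (x + v) - t *: (x + v) - (f x - t *: x) = f (x + v) - f x - t *: v.
  by apply/rowP => i; rewrite !mxE; ring.
rewrite dotBr dotZr lerBrDr.
apply: (lipschitz_mean_value K0 lipf) xr xvr => z zr dz.
have [A LA zA] := near z zr dz.
have := slope A LA; rewrite mulmxBr mul_mx_scalar dotBr dotZr => H.
have -> : 'J f z = A + ('J f z - A) by rewrite addrC subrK.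
rewrite mulmxDr dotDr.
have : `|dot w (v *m ('J f z - A))| <= n%:R ^+ 2 * e * `|v| * `|w|.
  apply: le_trans (normr_dot_le _ _) _.
  have := norm_mulmx_le v ('J f z - A).
  rewrite (_ : n%:R ^+ 2 * e * `|v| * `|w| = n%:R * `|w| * (n%:R * `|v| * e)); last by ring.
  move=> H1; apply: ler_wpM2l; first by rewrite mulr_ge0.
  by apply: le_trans H1 _; rewrite ler_wpM2l ?mulr_ge0// ltW.
rewrite ler_norml => /andP[].
by move: H; move: (dot _ _) (dot _ _) (dot _ _) (n%:R ^+ 2 * _ * _ * _) => *; lra.
Qed.

(** Expansivity uses the half-space containing the vectors [v (A - t)], [v = x - y]. For ascent,
    [dot w (v (A - t)) = dot v (w (A - t)^T)], so the normal of a half-space containing the vectors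
    [w (A - t)^T] is itself the direction sought. In the final constant, [2] pays for approximating
    Jacobians and [n.+1] for passing from [dot] to the norm. *)
Lemma regular_near_of_coercive (x0 : 'rV[R]_n) (t c : R) : 0 < c ->
  (forall A, clarke_differential f x0 A -> forall v : 'rV[R]_n,
     c * `|v| <= `|v *m (A - t%:M)| /\ c * `|v| <= `|v *m (A - t%:M)^T|) ->
  exists2 r : R, 0 < r & regular_near (fun x => f x - t *: x) x0 r (c / (2 * n.+1%:R)).
Proof.
move=> c0 coer.
have cH : compact (hull x0) by apply: compact_iter_join; exact: compact_limiting_jacobians lipf _.
have LH : limiting_jacobians f x0 `<=` hull x0 by exact: (@iter_join_le _ _ _ 0%N).
have HC : hull x0 `<=` clarke_differential f x0 by exact: iter_join_hull.
have convH A B (l : R) : 0 <= l <= 1 -> hull x0 A -> hull x0 B -> hull x0 (l *: A + (1 - l) *: B).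
  exact: iter_join_convex.
pose e := c / (2 * (n%:R ^+ 2 + 1)).
have n21 : 0 < n%:R ^+ 2 + 1 :> R by rewrite ltr_wpDl// sqr_ge0.
have e0 : 0 < e by rewrite divr_gt0// mulr_gt0.
have ne : n%:R ^+ 2 * e <= c / 2.
  have : e * (2 * (n%:R ^+ 2 + 1)) = c by rewrite divfK// gt_eqF// mulr_gt0.
  by move: (n%:R ^+ 2) n21 e0 => *; nra.
have [r r0 near] := jacobian_near_limiting K0 lipf x0 e0.
have c1 : c / (2 * n.+1%:R) <= c / 2.
  rewrite invfM mulrA ler_piMr ?divr_ge0 ?invf_le1 ?ltr0n ?ler1n//; exact: ltW.
have slope := slope_near near.
exists r => //; split=> [x y xr yr|w].
  have [->|yx] := eqVneq y x; first by rewrite !subrr !normr0 mulr0.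
  pose v := x - y.
  have v0 : 0 < `|v| by rewrite normr_gt0 subr_eq0 eq_sym.
  have [A B l|A B|||w w1 wP] :=
      @compact_convex_image_separation _ (fun A => v *m (A - t%:M)) (n%:R * `|v|) (c * `|v|) cH convH.
  - rewrite !scalemxAr -mulmxDr; congr (_ *m _).
    by apply/matrixP => i j; rewrite !mxE; ring.
  - rewrite -mulmxBr; apply: le_trans (norm_mulmx_le _ _) _.
    by rewrite opprB addrA subrK.
  - exact: mulr_gt0.
  - by move=> A /HC/coer/(_ v)[].
  have := slope v w t (c * `|v|) (fun A LA => wP A (LH A LA)) y yr.
  have -> : y + v = x by rewrite /v addrC subrK.
  move=> /(_ xr) H.
  have {}H := le_trans H (le_trans (ler_norm _) (normr_dot_le _ _)).
  rewrite mulrAC ler_pdivrMr ?mulr_gt0//.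
  have : n%:R * `|w| * `|f x - t *: x - (f y - t *: y)| <= n.+1%:R * `|f x - t *: x - (f y - t *: y)|.
    rewrite ler_wpM2r//; apply: (@le_trans _ _ n%:R); first by rewrite ler_piMr.
    by rewrite ler_nat.
  have : n%:R ^+ 2 * e * `|v| * `|w| <= c / 2 * `|v|.
    apply: (@le_trans _ _ (n%:R ^+ 2 * e * `|v|)); last by rewrite ler_wpM2r.
    by rewrite ler_piMr// !mulr_ge0// ltW.
  by move: H; rewrite -/v; move: `|v| `|f x - _ - _| (n%:R * _ * _) (_ * `|w|) (n.+1%:R) => *; lra.
have [->|w0] := eqVneq w 0.
  exists 0; rewrite ?normr0// => z s _ _ _.
  by rewrite mulr0 dot0l.
have [A B l|A B|||v v1 vP] :=
    @compact_convex_image_separation _ (fun A => w *m (A - t%:M)^T) (n%:R * `|w|) (c * `|w|) cH convH.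
- rewrite !scalemxAr -mulmxDr; congr (_ *m _).
  by apply/matrixP => i j; rewrite !mxE; ring.
- rewrite -mulmxBr; apply: le_trans (norm_mulmx_le _ _) _.
  by rewrite -linearB/= opprB addrA subrK norm_trmx.
- by rewrite mulr_gt0// normr_gt0.
- by move=> A /HC/coer/(_ w)[].
exists v => // z s s0 zr zsr.
have svP A : limiting_jacobians f x0 A -> s * (c * `|w|) <= dot w ((s *: v) *m (A - t%:M)).
  move=> /LH/vP; rewrite -scalemxAl dotZr => H; apply: ler_wpM2l => //.
  by rewrite (le_trans H)// dot_mulmx_tr.
have := slope (s *: v) w t _ svP z zr zsr.
apply: le_trans.
have : n%:R ^+ 2 * e * `|s *: v| * `|w| <= c / 2 * s * `|w|.
  rewrite ler_wpM2r// normrZ ger0_norm//.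
  apply: (@le_trans _ _ (n%:R ^+ 2 * e * s)); last by rewrite ler_wpM2r.
  by rewrite ler_wpM2l ?ler_piMr// mulr_ge0// ?sqr_ge0// ltW.
have : c / (2 * n.+1%:R) * s * `|w| <= c / 2 * s * `|w| by rewrite !ler_wpM2r.
have -> : s * (c * `|w|) = c / 2 * s * `|w| + c / 2 * s * `|w| by field.
by move: (_ * s * `|w|) (_ * s * `|w|) (_ * `|s *: v| * _) => *; lra.
Qed.

End local_jacobians.

(** * Global injectivity *)

Section global_injectivity.
Context {R : realType} (n : nat).
Variables (g : 'rV[R]_n -> 'rV[R]_n) (K c : R).
Hypotheses (K0 : 0 <= K) (lipg : forall x y, `|g x - g y| <= K * `|x - y|).
Hypotheses (c0 : 0 < c) (regg : forall x : 'rV[R]_n, exists2 r : R, 0 < r & regular_near g x r c).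

(** Any radius below half of one valid at [x] is valid at all points near [x]; compactness then
    gives a common radius. *)
Lemma uniform_regular_near (C : set 'rV[R]_n) : compact C ->
  exists2 r : R, 0 < r & forall x, C x -> regular_near g x r c.
Proof.
move=> /compact_near_coveringP cC.
have : \forall r \near (0 : R)^'+, C `<=` (fun x => regular_near g x r c).
  apply: cC => x _; have [r r0 regx] := regg x.
  exists (ball x (r / 2), [set e | e < r / 2]) => /=.
    split; first by apply: nbhsx_ballx; rewrite divr_gt0.
    by apply: nbhs_right_lt; rewrite divr_gt0.
  move=> [y e] [/= yx er]; apply: regular_near_sub regx => //.
  by move: yx; rewrite -ball_normE /= distrC; move: `|_| => *; lra.
move=> H; have : \forall r \near (0 : R)^'+, 0 < r /\ C `<=` (fun x => regular_near g x r c).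
  by near=> r; split; near: r => //; exact: nbhs_right_gt.
by move=> /(@filter_ex _ _ _)[r [r0 rC]]; exists r.
Unshelve. all: by end_near. Qed.

(* Row [i] of an [N * N] grid lifts through [g] the loop
   [g a + (1 - i / N) (g P_j - g a)], [P_j = a + (j / N) (b - a)]; each row is
   solved for near the previous one, with both ends pinned at [a] and [b]. *)
Lemma injective_of_regular : injective g.
Proof.
move=> a b gab; pose D := `|b - a|.
have D0 : 0 <= D by exact: normr_ge0.
(* A row has at most [N] steps of length at most [K / c * (D / N)], so it stays within [K / c * D]
   of [a]: here one [c] for the whole space is essential. The summand [1] makes room for the segment
   of row [0]. *)
pose C := [set x : 'rV[R]_n | `|x - a| <= (K / c + 1) * D].
have cC : compact C.
  exact: compact_norm_ball.
have [rho rho0 regC] := uniform_regular_near cC.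
(* The three bounds serve, in turn, to solve for the next row within [rho / 4], to keep neighbours
   in a lifted row within [rho / 4], and to keep neighbours on the initial segment within [rho]. *)
have [N [N0 N1 N2 N3]] : exists N : nat, [/\ (0 < N)%N, n.+2%:R * (K * D / N%:R) < c * (rho / 4),
    K * D / N%:R < c * (rho / 4) & D / N%:R < rho].
  have K1 : 0 < n.+2%:R * K + 1 by rewrite ltr_wpDl// mulr_ge0.
  pose d := Num.min rho (c * (rho / 4) / (n.+2%:R * K + 1)).
  have d0 : 0 < d by rewrite lt_min rho0 divr_gt0// mulr_gt0// divr_gt0.
  have Dd : 0 <= D / d by rewrite divr_ge0// ltW.
  pose N := Num.bound (D / d).
  have DN : D / d < N%:R by exact: archi_boundP.
  have N0 : (0 < N)%N by rewrite -(ltr0n R); exact: le_lt_trans DN.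
  have ud : D / N%:R < d by rewrite ltr_pdivrMr ?ltr0n// mulrC -ltr_pdivrMr.
  have u0 : 0 <= D / N%:R by rewrite divr_ge0.
  have dK : d * (n.+2%:R * K + 1) <= c * (rho / 4) by rewrite -ler_pdivlMr// ge_min lexx orbT.
  have N1 : n.+2%:R * (K * D / N%:R) < c * (rho / 4).
    apply: lt_le_trans dK; rewrite -(mulrA K) mulrA mulrC.
    apply: (@le_lt_trans _ _ (d * (n.+2%:R * K))); last by rewrite ltr_pM2l// ltrDl.
    by rewrite ler_wpM2r ?mulr_ge0// ltW.
  exists N; split => //; last by apply: lt_le_trans ud _; rewrite ge_min lexx.
  apply: le_lt_trans N1; rewrite ler_peMl// ?ler1n//.
  by rewrite -mulrA mulr_ge0.
have NR0 : 0 < N%:R :> R by rewrite ltr0n.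
pose P (j : nat) : 'rV[R]_n := a + (j%:R / N%:R) *: (b - a).
pose h (i j : nat) := g a + (1 - i%:R / N%:R) *: (g (P j) - g a).
have PN : P N = b by rewrite /P divff ?gt_eqF// scale1r addrC subrK.
have P0 : P 0%N = a by rewrite /P mul0r scale0r addr0.
have PP j : `|P j.+1 - P j| = D / N%:R.
  have -> : P j.+1 - P j = N%:R^-1 *: (b - a).
    rewrite /P -natr1; move: N%:R^-1 => u; apply/rowP => k; rewrite !mxE; ring.
  by rewrite normrZ ger0_norm ?invr_ge0 ?(ltW NR0)// mulrC.
have gPP j : `|g (P j.+1) - g (P j)| <= K * D / N%:R.
  by apply: le_trans (lipg _ _) _; rewrite PP mulrA.
have gPa j : (j <= N)%N -> `|g (P j) - g a| <= K * D.
  move=> jN; apply: le_trans (lipg _ _) _; rewrite ler_wpM2l//.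
  rewrite /P addrAC subrr add0r normrZ ger0_norm ?divr_ge0 ?(ltW NR0)//.
  by rewrite ler_piMl// ler_pdivrMr// mul1r ler_nat.
pose row (i : nat) (X : nat -> 'rV[R]_n) := [/\ forall j, (j <= N)%N -> g (X j) = h i j,
  forall j, (j < N)%N -> c * `|X j.+1 - X j| <= `|h i j.+1 - h i j|, X 0%N = a & X N = b].
have hh i j : (i <= N)%N -> `|h i j.+1 - h i j| <= K * D / N%:R.
  move=> iN; have -> : h i j.+1 - h i j = (1 - i%:R / N%:R) *: (g (P j.+1) - g (P j)).
    by apply/rowP => k; rewrite !mxE; ring.
  have i1 : i%:R / N%:R <= 1 :> R by rewrite ler_pdivrMr// mul1r ler_nat.
  have i0 : 0 <= i%:R / N%:R :> R by rewrite divr_ge0// ltW.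
  rewrite normrZ ger0_norm ?subr_ge0//; apply: le_trans (gPP j).
  by rewrite ler_piMl// gerBl.
have step i X j : (i <= N)%N -> row i X -> (j < N)%N -> `|X j.+1 - X j| <= K / c * (D / N%:R).
  move=> iN [_ rX _ _] jN; rewrite mulrAC ler_pdivlMr// mulrC mulrA.
  exact: le_trans (rX j jN) (hh i j iN).
have inC i X j : (i <= N)%N -> row i X -> (j <= N)%N -> C (X j).
  move=> iN rX jN; rewrite /C /=.
  have : `|X j - a| <= j%:R * (K / c * (D / N%:R)).
    elim: j jN => [|j IH] jN.
      by have [_ _ -> _] := rX; rewrite subrr normr0 mul0r.
    rewrite -(subrKA (X j)); apply: le_trans (ler_normD _ _) _.
    rewrite -natr1 mulrDl mul1r addrC; apply: lerD; first by apply: IH; exact: ltnW.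
    exact: step rX jN.
  move=> /le_trans; apply.
  rewrite [leLHS](_ : _ = j%:R / N%:R * (K / c * D)); last by ring.
  have KD : 0 <= K / c * D by rewrite mulr_ge0// divr_ge0// ltW.
  apply: (@le_trans _ _ (K / c * D)); last by rewrite ler_wpM2r// lerDl.
  by rewrite ler_piMl// ler_pdivrMr// mul1r ler_nat.
have row0 : row 0%N P.
  have h0 j : h 0%N j = g (P j) by rewrite /h mul0r subr0 scale1r addrC subrK.
  split => // j jN; rewrite !h0.
  have CP : C (P j).
    rewrite /C /= /P addrAC subrr add0r normrZ ger0_norm ?divr_ge0 ?(ltW NR0)//.
    rewrite ler_wpM2r//; apply: (@le_trans _ _ 1).
      by rewrite ler_pdivrMr// mul1r ler_nat ltnW.
    by rewrite lerDr divr_ge0// ltW.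
  have [E _] := regC _ CP; apply: E; last by rewrite subrr normr0.
  by rewrite PP.
have rowS i X : (i < N)%N -> row i X -> exists Y, row i.+1 Y.
  move=> iN rX; have iN' := ltnW iN.
  have hS j : (j <= N)%N -> `|h i.+1 j - h i j| <= K * D / N%:R.
    move=> jN; have -> : h i.+1 j - h i j = - N%:R^-1 *: (g (P j) - g a).
      rewrite /h -natr1; move: N%:R^-1 => u; apply/rowP => k; rewrite !mxE; ring.
    rewrite normrZ normrN ger0_norm ?invr_ge0 ?(ltW NR0)// mulrC.
    by rewrite ler_wpM2r ?invr_ge0 ?(ltW NR0)// gPa.
  have /choice[Y YP] : forall j, exists y, (j <= N)%N -> `|y - X j| < rho / 4 /\ g y = h i.+1 j.
    move=> j; have [jN|jN] := leqP j N; last by exists 0.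
    have CX := inC i X j iN' rX jN.
    have [|||y yX gy] := @local_solvability R n g K c rho (rho / 4) (X j) (X j) (h i.+1 j) K0 lipg c0 (regC _ CX).
    - by rewrite divr_gt0.
    - by rewrite subrr normr0 add0r; move: rho0 => *; lra.
    - have [-> // _ _ _] := rX.
      by apply: le_lt_trans N1; rewrite ler_wpM2l// hS.
    by exists y.
  exists Y.
  (* At an end of the row the image does not move, so old and new points have equal images within
     one ball of expansivity and coincide. *)
  have end_fixed j : (j <= N)%N -> X j = P j -> g (P j) = g a -> Y j = P j.
    move=> jN XP gP; have [YX gY] := YP j jN.
    have [E _] := regC _ (inC i X j iN' rX jN).
    have := E (Y j) (X j); rewrite subrr normr0.
    have -> : g (Y j) = g (X j) by rewrite gY XP /h gP subrr scaler0 addr0.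
    rewrite subrr normr0 => /(_ _ rho0).
    have : `|Y j - X j| < rho by move: rho0 `|_| YX => *; lra.
    move=> /[swap] /[apply]; rewrite pmulr_rle0// normr_le0 subr_eq0 => /eqP ->.
    exact: XP.
  have [_ _ X0 XN] := rX; split.
  - by move=> j jN; have [] := YP j jN.
  - move=> j jN; have [Yj gYj] := YP j (ltnW jN); have [YSj gYSj] := YP j.+1 jN.
    (* [Y j] and [Y j.+1] are within [rho / 4] of [X j] and [X j.+1], themselves less than [rho / 4]
       apart, so both lie in the ball of radius [rho] around [X j]. *)
    have [E _] := regC _ (inC i X j iN' rX (ltnW jN)).
    rewrite -gYj -gYSj; apply: E; last by move: rho0 `|_| Yj => *; lra.
    rewrite -(subrKA (X j.+1)); apply: le_lt_trans (ler_normD _ _) _.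
    have [_ rXj _ _] := rX.
    have : `|X j.+1 - X j| < rho / 4.
      by rewrite -(ltr_pM2l c0); apply: le_lt_trans (rXj j jN) (le_lt_trans (hh i j iN') N2).
    by move: rho0 `|_| `|_| YSj => *; lra.
  - by rewrite -P0; apply: end_fixed; rewrite ?P0.
  - by rewrite -PN; apply: end_fixed; rewrite ?PN.
have [X [_ rX X0 XN]] : exists X, row N X.
  suff H i : (i <= N)%N -> exists X, row i X by exact: H.
  elim: i => [|i IH] iN; first by exists P.
  by have [X rX] := IH (ltnW iN); exact: rowS rX.
have hN j : h N j = g a by rewrite /h divff ?gt_eqF// subrr scale0r addr0.
have Xa j : (j <= N)%N -> X j = a.
  elim: j => [//|j IH] jN; have := rX j jN.
  rewrite !hN subrr normr0 pmulr_rle0// normr_le0 subr_eq0 => /eqP ->.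
  by rewrite IH// ltnW.
by rewrite -XN Xa.
Qed.

End global_injectivity.

(** * Coercivity of the Clarke differential, and passage to the limit *)

Lemma lipschitz_constant (R : realType) (V W : normedModType R) (f : V -> W) : lipschitz f ->
  exists2 K : R, 0 <= K & forall x y, `|f x - f y| <= K * `|x - y|.
Proof.
move=> [M [_ MP]]; exists (Num.max 0 (M + 1)) => [|x y]; first by rewrite le_max lexx.
have /MP/(_ (x, y)) : M < Num.max 0 (M + 1) by rewrite lt_max ltrDl ltr01 orbT.
exact.
Qed.

Lemma lipschitz_shift (R : realType) (V : normedModType R) (f : V -> V) (K : R) :
  (forall x y, `|f x - f y| <= K * `|x - y|) ->
  forall (t : R) x y, `|f x - t *: x - (f y - t *: y)| <= (K + `|t|) * `|x - y|.
Proof.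
move=> lipf t x y; rewrite opprD addrACA -opprD -scalerBr.
by apply: le_trans (ler_normB _ _) _; rewrite mulrDl normrZ lerD.
Qed.

Lemma convex_hull_iter_join (R : realType) p q (C : set 'M[R]_(p, q)) :
  convex_hull C = iter_join C (p * q).
Proof.
apply/seteqP; split; last exact: iter_join_hull.
apply: smallest_sub; last exact: (@iter_join_le _ _ _ 0%N).
move=> x y l /set_mem Cx /set_mem Cy; apply/mem_set.
by apply: (@iter_join_convex _ _ _ _ x y l%:num) => //; rewrite ge0 le1.
Qed.

Lemma convex_norm_ball (R : realType) (V : normedModType R) (K : R) : convex_set [set x : V | `|x| <= K].
Proof.
move=> x y l /set_mem /= xK /set_mem /= yK; apply/mem_set => /=.
have l0 : 0 <= l%:num by rewrite ge0.
have l1 : 0 <= 1 - l%:num by rewrite subr_ge0 le1.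
rewrite -[K](subrK (l%:num * K)) addrC -[X in X - _]mul1r -mulrBl.
apply: le_trans (ler_normD _ _) _; rewrite !normrZ !ger0_norm//.
by apply: lerD; exact: ler_wpM2l.
Qed.

Section clarke_coercivity.
Context {R : realType} (n : nat).
Variables (f : 'rV[R]_n -> 'rV[R]_n) (K : R).
Hypotheses (K0 : 0 <= K) (lipf : forall x y, `|f x - f y| <= K * `|x - y|).

Lemma compact_clarke_differential x : compact (clarke_differential f x).
Proof.
rewrite /clarke_differential convex_hull_iter_join; apply: compact_iter_join.
exact: compact_limiting_jacobians K0 lipf x.
Qed.

Lemma norm_clarke_differential_le x A : clarke_differential f x A -> `|A| <= K.
Proof.
move: A; apply: smallest_sub; first exact: convex_norm_ball.
by move=> A; exact: norm_limiting_jacobian_le.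
Qed.

(** The determinant is bounded below by compactness, so [c] depends on [x]; this serves the local
    regularity of [f] itself. *)
Lemma clarke_coercive_of_rank x : maximal_rank (clarke_differential f x) ->
  exists2 c : R, 0 < c & forall A, clarke_differential f x A -> forall v : 'rV[R]_n,
    c * `|v| <= `|v *m A| /\ c * `|v| <= `|v *m A^T|.
Proof.
move=> rank.
have [d d0 dP] : exists2 d : R, 0 < d & forall A, clarke_differential f x A -> d <= `|\det A|.
  have [C0|C0] := pselect (clarke_differential f x !=set0); last first.
    by exists 1 => // A CA; exfalso; apply: C0; exists A.
  have cdet : continuous (fun A : 'M[R]_n => `|\det A|).
    move=> A; apply: (@continuous_comp _ _ _ (fun A : 'M[R]_n => \det A) (fun u : R => `|u|)).
      exact: continuous_det.
    exact: norm_continuous.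
  have [A /set_mem CA Amin] := compact_EVT_min C0 (@compact_clarke_differential x) (continuous_subspaceT cdet).
  exists `|\det A| => [|B CB]; last exact/Amin/mem_set.
  by rewrite normr_gt0 -unitfE -/(_ \in unitmx); exact: rank.
have [c c0 cP] := coercive_of_det n K d0.
exists c => // A CA v; have AK := norm_clarke_differential_le CA.
by split; apply: cP; rewrite ?norm_trmx ?det_tr//; exact: dP.
Qed.

Local Open Scope complex_scope.

Lemma clarke_coercive_of_spectrum (t r : R) : 0 < r ->
  (forall x, Spec (clarke_differential f x) `&` closed_disc t%:C r = set0) ->
  exists2 c : R, 0 < c & forall x A, clarke_differential f x A -> forall v : 'rV[R]_n,
    c * `|v| <= `|v *m (A - t%:M)| /\ c * `|v| <= `|v *m (A - t%:M)^T|.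
Proof.
move=> r0 spec; have [c c0 cP] := coercive_of_det n (K + `|t|) (exprn_gt0 n r0).
exists c => // x A CA v.
have AK : `|A - t%:M| <= K + `|t|.
  apply: le_trans (ler_normB _ _) _; apply: lerD; first exact: norm_clarke_differential_le CA.
  apply: norm_le_entries => // i j; rewrite mxE.
  by case: (i == j); rewrite ?mulr1n// mulr0n normr0.
have dA : r ^+ n <= `|\det (A - t%:M)|.
  apply: normr_det_ge_spectrum; first exact: ltW.
  move=> z zA; have nz : ~ closed_disc t%:C r z.
    by move=> zD; have : set0 z by rewrite -(spec x); split => //; exists A.
  rewrite real_leNgt; [|by apply/complex_realP; exists r|exact: normr_real].
  by apply/negP => /ltW.
by split; apply: cP; rewrite ?norm_trmx ?det_tr.
Qed.

End clarke_coercivity.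

Local Open Scope complex_scope.

Theorem theorem4p8 (R : realType) (n : nat) (f : 'rV[R]_n -> 'rV[R]_n)
    (lip_f : lipschitz f)
    (rank_f : forall x : 'rV[R]_n, maximal_rank (clarke_differential f x))
    (D : nat -> set R[i]) (t : nat -> R)
    (disc_D : forall k : nat,
       exists2 r : R, 0 < r & D k = closed_disc (t k)%:C r)
    (cvg_t : t @ \oo --> (0 : R))
    (spec_D : forall x : 'rV[R]_n,
       Spec (clarke_differential f x) `&` \bigcup_k D k = set0) :
  injective f.
Proof.
have [K K0 lipf] := lipschitz_constant lip_f.
have inj_shift k : injective (fun x => f x - t k *: x).
  have [r r0 Dk] := disc_D k.
  have [|c c0 coer] := clarke_coercive_of_spectrum K0 lipf (t := t k) r0.
    move=> x; rewrite -subset0 => z [Sz dz]; rewrite -(spec_D x); split => //.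
    by exists k => //; rewrite Dk.
  apply: (@injective_of_regular R n _ (K + `|t k|) (c / (2 * n.+1%:R))).
  - by rewrite addr_ge0.
  - exact: lipschitz_shift.
  - by rewrite divr_gt0// mulr_gt0.
  - by move=> x; apply: (regular_near_of_coercive K0 lipf) => //; exact: coer.
have regf x : exists r c : R, [/\ 0 < r, 0 < c & regular_near f x r c].
  have [c c0 coer] := clarke_coercive_of_rank K0 lipf (rank_f x).
  have [|r r0 reg] := regular_near_of_coercive K0 lipf (t := 0) c0 (x0 := x).
    by move=> A CA v; rewrite raddf0 subr0; exact: coer.
  exists r, (c / (2 * n.+1%:R)); split => //; first by rewrite divr_gt0// mulr_gt0.
  by move: reg; congr (regular_near _ _ _ _); apply/funext => y; rewrite scale0r subr0.
(* The radius and constant of [f] at [a] are fixed before [k], so all conditions on [t k] below are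
   smallness conditions. *)
have solve a (rho : R) : 0 < rho -> \forall k \near \oo, exists2 x : 'rV[R]_n,
    `|x - a| < rho & f x - t k *: x = f a.
  move=> rho0; have [r [c [r0 c0 reg]]] := regf a.
  pose s := Num.min rho (r / 2).
  have s0 : 0 < s by rewrite lt_min rho0 divr_gt0.
  have sr : s < r by rewrite gt_min; apply/orP; right; lra.
  near=> k.
  have tk1 : `|t k| * n.+1%:R <= c / 2.
    rewrite -ler_pdivlMr// ltW//; near: k; move: cvg_t => /cvgr0_norm_lt; apply.
    by rewrite !divr_gt0.
  (* At [x = a] the residual [f a - (f a - t k *: a)] is [t k *: a]; the [1] avoids dividing by zero
     when [a = 0]. *)
  have tk2 : `|t k| * (n.+2%:R * (`|a| + 1)) < c / 2 * s.
    rewrite -ltr_pdivlMr ?mulr_gt0 ?ltr_wpDl//; near: k; move: cvg_t => /cvgr0_norm_lt; apply.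
    by rewrite divr_gt0 ?mulr_gt0 ?divr_gt0 ?ltr_wpDl.
  have [||||x xa fx] := @local_solvability _ _ _ (K + `|t k|) _ _ s a a (f a)
    _ (lipschitz_shift lipf (t k)) _ (regular_near_shift tk1 reg) s0.
  - by rewrite addr_ge0.
  - by rewrite divr_gt0.
  - by rewrite subrr normr0 add0r.
  - rewrite opprB addrCA subrr addr0 normrZ mulrCA; apply: le_lt_trans tk2.
    by rewrite !ler_wpM2l// lerDl.
  by exists x => //; apply: lt_le_trans xa _; rewrite ge_min lexx.
move=> a b fab; apply/eqP/negPn/negP => ab.
(* Balls of this radius around [a] and [b] are disjoint, so the two solutions differ. *)
have ab0 : 0 < `|a - b| / 2 by rewrite divr_gt0// normr_gt0 subr_eq0.
have [k [[x xa fx] [y yb fy]]] := filter_ex (filterI (solve a _ ab0) (solve b _ ab0)).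
have xy : x = y by apply: (inj_shift k); rewrite fx fy.
have := ler_distD x a b.
by rewrite (distrC a x) leNgt => /negP; apply; rewrite [ltRHS]splitr ltrD// xy.
Unshelve. all: by end_near.
Qed.
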